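(* Let $T$ be any set theory in the language $\{\in,=\}$ with $T\supset \mathsf{BS}$, and let $\mathcal{Q}(X,x)$ be any formula in the language $\{\in,=,X\}$, with $X$ an extra unary predicate symbol, that is strictly positive with respect to $X$. Let $\mathrm{FiX}^{i}(T)$ be the intuitionistic fixed point theory over $T$ for $\mathcal{Q}(X,x)$. Then $\mathrm{FiX}^{i}(T)$ is a conservative extension of $T$. That is, every sentence of the language $\{\in,=\}$ provable in $T$ is provable in $\mathrm{FiX}^{i}(T)$, and every sentence of the language $\{\in,=\}$ provable in $\mathrm{FiX}^{i}(T)$ is provable in $T$.
   Context: **Basic set theory $\mathsf{BS}$.** Ordered pairs and triples are $\langle v,u\rangle=\{v,\{v,u\}\}$ and $\langle u,v,w\rangle=\langle u,\langle v,w\rangle\rangle$. Consider the binary functions: $\mathcal{F}_{0}(x,y)=\{x,y\}$; $\mathcal{F}_{1}(x,y)=\cup x$; $\mathcal{F}_{2}(x,y)=x\setminus y$; $\mathcal{F}_{3}(x,y)=\{u\cup\{v\}: u\in x, v\in y\}$; $\mathcal{F}_{4}(x,y)=dom(x)=\{u\in\cup\cup x:\exists v\in\cup\cup x\,(\langle u,v\rangle\in x)\}$; $\mathcal{F}_{5}(x,y)=rng(x)=\{v\in\cup\cup x:\exists u\in\cup\cup x\,(\langle u,v\rangle\in x)\}$; $\mathcal{F}_{6}(x,y)=\{\langle v,u\rangle\in y\times x: v\in u\}$; $\mathcal{F}_{7}(x,y)=\{\langle u,v,w\rangle:\langle u,v\rangle\in x, w\in y\}$; $\mathcal{F}_{8}(x,y)=\{\langle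 u,w,v\rangle:\langle u,v\rangle\in x, w\in y\}$. For each $i<9$, $\mathcal{F}_i(x,y,z)$ denotes a $\Delta_0$-formula expressing $\mathcal{F}_i(x,y)=z$. $\mathsf{BS}$ is the first-order theory in the language $\{\in,=\}$ with axioms: Extensionality; the Foundation schema $\forall x(\forall y\in x\,\varphi(y)\to\varphi(x))\to\forall x\,\varphi(x)$ for every formula $\varphi$ of $\{\in,=\}$; and $\forall x,y\,\exists z\,\mathcal{F}_i(x,y,z)$ for each $i<9$. $T$ and $\mathsf{BS}$ are theories in classical first-order logic with equality. **Strictly positive formulas.** The logical connectives are $\lor,\land,\to,\exists,\forall$ (and $\lnot A$ is $A\to\bot$). A formula is strictly positive with respect to $X$ if $X$ does not occur in the antecedent $\varphi$ of any implication $\varphi\to\psi$ in it, nor in the scope of a negation. **The theory $\mathrm{FiX}^{i}(T)$.** Fix an $X$-strictly positive formula $\mathcal{Q}(X,x)$ of $\{\in,=,X\}$ whose only free individual variable is $x$. The language of $\mathrm{FiX}^{i}(T)$ is $\{\in,=,Q\}$ with a fresh unary predicate symbol $Q$. Its underlying logic is intuitionistic first-order predicate logic with equality (in particular $\forall x,y(x=y\to Q(x)\to Q(y))$ is an axiom). Its axioms are: (1) all sentences of $\{\in,=\}$ provable in $T$; (2) the Foundation schema $\forall x(\forall y\in x\,\varphi(y)\to\varphi(x))\to\forall x\,\varphi(x)$ for every formula $\varphi$ of the language $\{\in,=,Q\}$; (3) the fixed point axiom $\forall x[Q(x)\leftrightarrow\mathcal{Q}(Q,x)]$, where $\mathcal{Q}(Q,x)$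 is obtained from $\mathcal{Q}(X,x)$ by replacing $X$ by $Q$. *)

(* Defs.v *)
From Stdlib Require Import List.

(** [form P] is the set of first-order formulas over [{∈, =}] extended by the
    unary predicate symbols in [P].  Variables are de Bruijn indices; as there
    are no function symbols, a term is a variable.  Negation is [Imp A Bot]. *)

Inductive form (P : Type) : Type :=
| Bot
| Mem (x y : nat)
| Eq (x y : nat)
| Atom (p : P) (x : nat)
| And (A B : form P)
| Or (A B : form P)
| Imp (A B : form P)
| All (A : form P)
| Ex (A : form P).

Arguments Bot {P}.
Arguments Mem {P} x y.
Arguments Eq {P} x y.
Arguments Atom {P} p x.
Arguments And {P} A B.
Arguments Or {P} A B.
Arguments Imp {P} A B.
Arguments All {P} A.
Arguments Ex {P} A.

Definition Neg {P} (A : form P) : form P := Imp A Bot.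
Definition Iff {P} (A B : form P) : form P := And (Imp A B) (Imp B A).

Definition up (r : nat -> nat) (n : nat) : nat :=
  match n with O => O | S k => S (r k) end.

(* Simultaneous capture-avoiding substitution of variables for variables. *)
Fixpoint ren {P} (r : nat -> nat) (A : form P) : form P :=
  match A with
  | Bot => Bot
  | Mem x y => Mem (r x) (r y)
  | Eq x y => Eq (r x) (r y)
  | Atom p x => Atom p (r x)
  | And A B => And (ren r A) (ren r B)
  | Or A B => Or (ren r A) (ren r B)
  | Imp A B => Imp (ren r A) (ren r B)
  | All A => All (ren (up r) A)
  | Ex A => Ex (ren (up r) A)
  end.

Definition shift {P} (A : form P) : form P := ren S A.

(* [inst A y] is the body [A] of a quantifier with its bound variable
   replaced by [y]. *)
Definition inst {P} (A : form P) (y : nat) : form P :=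
  ren (fun n => match n with O => y | S k => k end) A.

(* All free variables of [A] are among [0, ..., n - 1]. *)
Fixpoint closed_below {P} (n : nat) (A : form P) : Prop :=
  match A with
  | Bot => True
  | Mem x y | Eq x y => x < n /\ y < n
  | Atom _ x => x < n
  | And A B | Or A B | Imp A B => closed_below n A /\ closed_below n B
  | All A | Ex A => closed_below (S n) A
  end.

Definition sentence {P} (A : form P) : Prop := closed_below 0 A.

Fixpoint alls {P} (n : nat) (A : form P) : form P :=
  match n with O => A | S k => All (alls k A) end.

Fixpoint map_pred {P P'} (f : P -> P') (A : form P) : form P' :=
  match A with
  | Bot => Bot
  | Mem x y => Mem x y
  | Eq x y => Eq x y
  | Atom p x => Atom (f p) x
  | And A B => And (map_pred f A) (map_pred f B)
  | Or A B => Or (map_pred f A) (map_pred f B)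
  | Imp A B => Imp (map_pred f A) (map_pred f B)
  | All A => All (map_pred f A)
  | Ex A => Ex (map_pred f A)
  end.

Inductive X_symbol : Set := X.
Inductive Q_symbol : Set := Q.

Definition set_form : Type := form Empty_set.
Definition X_form : Type := form X_symbol.
Definition Q_form : Type := form Q_symbol.

Definition embed (A : set_form) : Q_form :=
  map_pred (fun e : Empty_set => match e with end) A.

Definition replace_X_by_Q (A : X_form) : Q_form := map_pred (fun _ => Q) A.

Inductive logic : Set := intuitionistic | classical.

Inductive nd {P} (l : logic) : list (form P) -> form P -> Prop :=
| nd_hyp G A : In A G -> nd l G A
| nd_botE G A : nd l G Bot -> nd l G A
| nd_dne G A : l = classical -> nd l G (Neg (Neg A)) -> nd l G A
| nd_andI G A B : nd l G A -> nd l G B -> nd l G (And A B)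
| nd_andE1 G A B : nd l G (And A B) -> nd l G A
| nd_andE2 G A B : nd l G (And A B) -> nd l G B
| nd_orI1 G A B : nd l G A -> nd l G (Or A B)
| nd_orI2 G A B : nd l G B -> nd l G (Or A B)
| nd_orE G A B C :
    nd l G (Or A B) -> nd l (A :: G) C -> nd l (B :: G) C -> nd l G C
| nd_impI G A B : nd l (A :: G) B -> nd l G (Imp A B)
| nd_impE G A B : nd l G (Imp A B) -> nd l G A -> nd l G B
| nd_allI G A : nd l (map shift G) A -> nd l G (All A)
| nd_allE G A y : nd l G (All A) -> nd l G (inst A y)
| nd_exI G A y : nd l G (inst A y) -> nd l G (Ex A)
| nd_exE G A C :
    nd l G (Ex A) -> nd l (A :: map shift G) (shift C) -> nd l G C
| nd_eqI G x : nd l G (Eq x x)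
| nd_eqE G A x y : nd l G (Eq x y) -> nd l G (inst A x) -> nd l G (inst A y).

Definition provable {P} (l : logic) (T : form P -> Prop) (A : form P) : Prop :=
  exists G, (forall B, In B G -> T B) /\ nd l G A.

(** To write closed formulas with named variables, a variable is represented
    by its de Bruijn level (the number of quantifiers above its binder), and a
    formula by the function taking the current quantifier depth to the de
    Bruijn formula; level [x] at depth [d] is the index [d - S x]. *)

Definition lform : Type := nat -> set_form.

Definition lMem (x y : nat) : lform := fun d => Mem (d - S x) (d - S y).
Definition lEq (x y : nat) : lform := fun d => Eq (d - S x) (d - S y).
Definition lNeg (A : lform) : lform := fun d => Neg (A d).
Definition lAnd (A B : lform) : lform := fun d => And (A d) (B d).
Definition lOr (A B : lform) : lform := fun d => Or (A d) (B d).
Definition lImp (A B : lform) : lform := fun d => Imp (A d) (B d).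
Definition lIff (A B : lform) : lform := fun d => Iff (A d) (B d).
Definition lAll (A : nat -> lform) : lform := fun d => All (A d (S d)).
Definition lEx (A : nat -> lform) : lform := fun d => Ex (A d (S d)).

Definition closed_form (A : lform) : set_form := A 0.

Declare Scope lform_scope.
Delimit Scope lform_scope with L.
Bind Scope lform_scope with lform.

Notation "x ∈ y" := (lMem x y) (at level 70) : lform_scope.
Notation "x ≡ y" := (lEq x y) (at level 70) : lform_scope.
Notation "¬ A" := (lNeg A) (at level 75, right associativity) : lform_scope.
Notation "A ∧ B" := (lAnd A B) (at level 80, right associativity) : lform_scope.
Notation "A ∨ B" := (lOr A B) (at level 85, right associativity) : lform_scope.
Notation "A ⇒ B" := (lImp A B) (at level 99, right associativity, B at level 200)
  : lform_scope.
Notation "A ⇔ B" := (lIff A B) (at level 95, no associativity) : lform_scope.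
Notation "∀ x , A" := (lAll (fun x => A%L))
  (at level 200, x name, right associativity) : lform_scope.
Notation "∃ x , A" := (lEx (fun x => A%L))
  (at level 200, x name, right associativity) : lform_scope.
Notation "∀ x ∈ y , A" := (lAll (fun x => lImp (lMem x y) A%L))
  (at level 200, x name, y at level 69, right associativity) : lform_scope.
Notation "∃ x ∈ y , A" := (lEx (fun x => lAnd (lMem x y) A%L))
  (at level 200, x name, y at level 69, right associativity) : lform_scope.

Local Open Scope lform_scope.

(* z = {x, y} *)
Definition is_upair (x y z : nat) : lform :=
  x ∈ z ∧ y ∈ z ∧ (∀ t ∈ z, t ≡ x ∨ t ≡ y).

(* p = ⟨v, u⟩ = {v, {v, u}}; this is not the Kuratowski pair. *)
Definition is_pair (v u p : nat) : lform :=
  v ∈ p ∧ (∃ q ∈ p, is_upair v u q) ∧ (∀ t ∈ p, t ≡ v ∨ is_upair v u t).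

Definition pair_in (v u x : nat) : lform := ∃ p ∈ x, is_pair v u p.

(* t = ⟨u, v, w⟩ = ⟨u, ⟨v, w⟩⟩; the inner pair belongs to {u, ⟨v, w⟩} ∈ t. *)
Definition is_triple (u v w t : nat) : lform :=
  ∃ s ∈ t, ∃ r ∈ s, is_pair v w r ∧ is_pair u r t.

(* w = u ∪ {v} *)
Definition is_adjoin (u v w : nat) : lform :=
  (∀ t ∈ w, t ∈ u ∨ t ≡ v) ∧ (∀ t ∈ u, t ∈ w) ∧ v ∈ w.

(* [F i x y z] is a Δ₀-formula expressing 𝓕ᵢ(x, y) = z.  In [F7] and [F8] the
   components of a pair p = ⟨u, v⟩ are bounded by {u, v} ∈ p. *)
Definition F0 (x y z : nat) : lform := is_upair x y z.

Definition F1 (x y z : nat) : lform :=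
  (∀ u ∈ z, ∃ v ∈ x, u ∈ v) ∧ (∀ v ∈ x, ∀ u ∈ v, u ∈ z).

Definition F2 (x y z : nat) : lform :=
  (∀ u ∈ z, u ∈ x ∧ ¬ u ∈ y) ∧ (∀ u ∈ x, ¬ u ∈ y ⇒ u ∈ z).

Definition F3 (x y z : nat) : lform :=
  (∀ w ∈ z, ∃ u ∈ x, ∃ v ∈ y, is_adjoin u v w) ∧
  (∀ u ∈ x, ∀ v ∈ y, ∃ w ∈ z, is_adjoin u v w).

Definition F4 (x y z : nat) : lform :=
  (∀ u ∈ z, (∃ a ∈ x, ∃ b ∈ a, u ∈ b) ∧
            (∃ a ∈ x, ∃ b ∈ a, ∃ v ∈ b, pair_in u v x)) ∧
  (∀ a ∈ x, ∀ b ∈ a, ∀ u ∈ b,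
     (∃ c ∈ x, ∃ d ∈ c, ∃ v ∈ d, pair_in u v x) ⇒ u ∈ z).

Definition F5 (x y z : nat) : lform :=
  (∀ v ∈ z, (∃ a ∈ x, ∃ b ∈ a, v ∈ b) ∧
            (∃ a ∈ x, ∃ b ∈ a, ∃ u ∈ b, pair_in u v x)) ∧
  (∀ a ∈ x, ∀ b ∈ a, ∀ v ∈ b,
     (∃ c ∈ x, ∃ d ∈ c, ∃ u ∈ d, pair_in u v x) ⇒ v ∈ z).

Definition F6 (x y z : nat) : lform :=
  (∀ p ∈ z, ∃ v ∈ y, ∃ u ∈ x, is_pair v u p ∧ v ∈ u) ∧
  (∀ v ∈ y, ∀ u ∈ x, v ∈ u ⇒ pair_in v u z).

Definition F7 (x y z : nat) : lform :=
  (∀ t ∈ z, ∃ p ∈ x, ∃ q ∈ p, ∃ u ∈ q, ∃ v ∈ q, ∃ w ∈ y,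
     is_pair u v p ∧ is_triple u v w t) ∧
  (∀ p ∈ x, ∀ q ∈ p, ∀ u ∈ q, ∀ v ∈ q, ∀ w ∈ y,
     is_pair u v p ⇒ ∃ t ∈ z, is_triple u v w t).

Definition F8 (x y z : nat) : lform :=
  (∀ t ∈ z, ∃ p ∈ x, ∃ q ∈ p, ∃ u ∈ q, ∃ v ∈ q, ∃ w ∈ y,
     is_pair u v p ∧ is_triple u w v t) ∧
  (∀ p ∈ x, ∀ q ∈ p, ∀ u ∈ q, ∀ v ∈ q, ∀ w ∈ y,
     is_pair u v p ⇒ ∃ t ∈ z, is_triple u w v t).

Definition rudimentary : list (nat -> nat -> nat -> lform) :=
  F0 :: F1 :: F2 :: F3 :: F4 :: F5 :: F6 :: F7 :: F8 :: nil.

Definition extensionality : set_form :=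
  closed_form (∀ x, ∀ y, (∀ z, z ∈ x ⇔ z ∈ y) ⇒ x ≡ y).

Definition totality (F : nat -> nat -> nat -> lform) : set_form :=
  closed_form (∀ x, ∀ y, ∃ z, F x y z).

(* ∀x(∀y∈x φ(y) → φ(x)) → ∀x φ(x), where variable 0 of [A] is the argument of
   φ and the other variables are parameters. *)
Definition foundation {P} (A : form P) : form P :=
  Imp (All (Imp (All (Imp (Mem 0 1) (ren (up S) A))) A)) (All A).

(* Instances may have parameters; [alls n] closes them universally. *)
Inductive foundation_schema {P} : form P -> Prop :=
| foundation_instance n A :
    sentence (alls n (foundation A)) ->
    foundation_schema (alls n (foundation A)).

Inductive BS : set_form -> Prop :=
| BS_extensionality : BS extensionality
| BS_foundation A : foundation_schema A -> BS A
| BS_totality F : In F rudimentary -> BS (totality F).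

(* A set [T] of sentences is identified with the classical theory it
   axiomatizes, so that T ⊃ BS means that every axiom of BS is a theorem. *)
Definition contains_BS (T : set_form -> Prop) : Prop :=
  forall A, BS A -> provable classical T A.

Fixpoint X_free (A : X_form) : Prop :=
  match A with
  | Bot | Mem _ _ | Eq _ _ => True
  | Atom _ _ => False
  | And A B | Or A B | Imp A B => X_free A /\ X_free B
  | All A | Ex A => X_free A
  end.

Fixpoint strictly_positive (A : X_form) : Prop :=
  match A with
  | Bot | Mem _ _ | Eq _ _ | Atom _ _ => True
  | And A B | Or A B => strictly_positive A /\ strictly_positive B
  | Imp A B => X_free A /\ strictly_positive B
  | All A | Ex A => strictly_positive A
  end.

(* The variable x of 𝓠(X, x) is variable 0. *)
Definition fixed_point_axiom (D : X_form) : Q_form :=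
  All (Iff (Atom Q 0) (replace_X_by_Q D)).

(* The axioms of FiXⁱ(T), to be used with intuitionistic logic. *)
Inductive FiX (T : set_form -> Prop) (D : X_form) : Q_form -> Prop :=
| FiX_theorem A : sentence A -> provable classical T A -> FiX T D (embed A)
| FiX_foundation A : foundation_schema A -> FiX T D A
| FiX_fixed_point : FiX T D (fixed_point_axiom D).

(* Main.v *)
Require Import Defs.
From Stdlib Require Import List Arith Lia Cantor Classical ClassicalEpsilon
  FunctionalExtensionality PropExtensionality.

(** One half is immediate, as the theorems of [T] are axioms of the fixed point
    theory.  For the other half suppose that [T] does not prove [A].  By
    [completeness] some model of [T] refutes [A].  Over this model, which may
    well be ill-founded, the fixed point theory is interpreted by a
    realizability whose realizers are elements of the model, and the sentences
    without [Q] that have a realizer turn out to be the true ones.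

    The foundation schema holds in the model for definable classes only, so
    the relation of realizing a given formula must be definable.  This is the
    reason for the two features of the interpretation.

    First, realizers are codes for nondeterministic programs: a program
    is good for a formula if it has a value and all its values realize the
    formula.  [T] may prove an existential sentence without having a definable
    choice of a witness; the program just returns every witness.  The programs
    may consult truth in the model for the finitely many formulas that occur
    in a given derivation ([oracle_exists], [truth_realized]), and truth of
    these is definable one at a time although there is no truth definition.
    The application relation is a fixed point of a monotone operator whose
    instances have finitely many premises.  Such an operator [F] has a
    definable fixed point, namely the union of all sets [d] of the model with
    [d] included in [F d]; pairing and union in the model are enough to see
    this ([fixpoint_unfold]).

    Second, realizing a strictly positive formula is deterministic in the
    predicate: the realizer supplies all disjuncts and witnesses, and what
    remains to be said of [Q] is a universally quantified conjunction
    ([deterministic_realizes]).  A relation [RQ] with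
    [RQ h x <-> C h x /\ forall h' x', R h x h' x' -> RQ h' x'] is the complement of a
    fixed point whose instances have at most one premise, so again it is definable
    ([fixed_point_exists]).  Interpreting [Q] by it makes both directions of
    the fixed point axiom realized by the identity.

    Foundation is realized by a fixed point combinator; that it works is an
    instance of foundation in the model, for the definable class of those [x]
    at which the recursive program is good ([foundation_realized]).
    Intuitionistic derivations are sound for this notion ([soundness]), so a
    sentence without [Q] that is derivable in the fixed point theory has a
    realizer and is true in the model, a contradiction for [A]. *)

(** * Renaming and closedness *)

Definition scons {D} (x : D) (r : nat -> D) (n : nat) : D :=
  match n with O => x | S k => r k end.

Lemma scons_eta D (r : nat -> D) : scons (r 0) (fun n => r (S n)) = r.
Proof. apply functional_extensionality; intros [|n]; reflexivity. Qed.

Lemma up_comp f g : (fun n => up f (up g n)) = up (fun n => f (g n)).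
Proof. apply functional_extensionality; intros [|n]; reflexivity. Qed.

Lemma ren_ren P (A : form P) : forall f g,
  ren f (ren g A) = ren (fun n => f (g n)) A.
Proof.
  induction A; intros f g; cbn; rewrite ?IHA, ?IHA1, ?IHA2, ?up_comp; reflexivity.
Qed.

Lemma ren_ext_below P (A : form P) : forall n f g,
  closed_below n A -> (forall k, k < n -> f k = g k) -> ren f A = ren g A.
Proof.
  assert (U : forall n f g, (forall k, k < n -> f k = g k) ->
            forall k, k < S n -> up f k = up g k).
  { intros n f g H [|k] Hk; cbn; [reflexivity|]. rewrite H by lia. reflexivity. }
  induction A; cbn; intros n f g Hc H; try match type of Hc with _ /\ _ => destruct Hc end; f_equal; eauto.
Qed.

Lemma ren_id P (A : form P) : ren (fun n => n) A = A.
Proof.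
  assert (U : up (fun n => n) = fun n => n).
  { apply functional_extensionality; intros [|n]; reflexivity. }
  induction A; cbn; rewrite ?U, ?IHA, ?IHA1, ?IHA2; reflexivity.
Qed.

Lemma ren_shift P (A : form P) r : ren (up r) (shift A) = shift (ren r A).
Proof. unfold shift. rewrite !ren_ren. reflexivity. Qed.

Lemma ren_inst P (A : form P) r y : ren r (inst A y) = inst (ren (up r) A) (r y).
Proof.
  unfold inst. rewrite !ren_ren. f_equal.
  apply functional_extensionality; intros [|n]; reflexivity.
Qed.

Lemma closed_below_le P (A : form P) : forall n m,
  n <= m -> closed_below n A -> closed_below m A.
Proof.
  induction A; cbn; intros n m Hm Hc; try match type of Hc with _ /\ _ => destruct Hc end; try split; eauto; try lia.
  all: eapply IHA; [|eassumption]; lia.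
Qed.

Lemma closed_below_exists P (A : form P) : exists n, closed_below n A.
Proof.
  induction A as [|x y|x y|p x|A [n Hn] B [m Hm]|A [n Hn] B [m Hm]
    |A [n Hn] B [m Hm]|A [n Hn]|A [n Hn]]; cbn.
  - exists 0; trivial.
  - exists (S (x + y)); lia.
  - exists (S (x + y)); lia.
  - exists (S x); lia.
  - exists (n + m); split; (eapply closed_below_le; [|eassumption]); lia.
  - exists (n + m); split; (eapply closed_below_le; [|eassumption]); lia.
  - exists (n + m); split; (eapply closed_below_le; [|eassumption]); lia.
  - exists n. apply closed_below_le with n; auto.
  - exists n. apply closed_below_le with n; auto.
Qed.

Lemma closed_below_ren P (A : form P) : forall n m r,
  closed_below n A -> (forall k, k < n -> r k < m) -> closed_below m (ren r A).
Proof.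
  assert (U : forall n m r, (forall k, k < n -> r k < m) ->
            forall k, k < S n -> up r k < S m).
  { intros n m r H [|k] Hk; cbn; [lia|]. specialize (H k). lia. }
  induction A; cbn; intros n m r Hc H; try match type of Hc with _ /\ _ => destruct Hc end; try split; eauto.
Qed.

Lemma closed_below_alls P (A : form P) : forall n m,
  closed_below (n + m) A -> closed_below m (alls n A).
Proof.
  induction n as [|n IH]; cbn; intros m H; [assumption|].
  apply IH. rewrite Nat.add_succ_r. assumption.
Qed.

(** * Structural properties of deduction *)

Lemma nd_weaken P l (G : list (form P)) A :
  nd l G A -> forall G', incl G G' -> nd l G' A.
Proof.
  assert (C : forall (G G' : list (form P)) A, incl G G' -> incl (A :: G) (A :: G')).
  { intros G1 G2 B H E [->|HE]; [left; reflexivity|right; auto]. }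
  induction 1; intros G' HG.
  - apply nd_hyp; auto.
  - apply nd_botE; auto.
  - apply nd_dne; auto.
  - apply nd_andI; auto.
  - eapply nd_andE1; auto.
  - eapply nd_andE2; auto.
  - apply nd_orI1; auto.
  - apply nd_orI2; auto.
  - eapply nd_orE; eauto.
  - apply nd_impI; auto.
  - eapply nd_impE; eauto.
  - apply nd_allI. apply IHnd. apply incl_map; assumption.
  - apply nd_allE; auto.
  - eapply nd_exI; eauto.
  - eapply nd_exE; [eauto|]. apply IHnd2. apply C. apply incl_map; assumption.
  - apply nd_eqI.
  - eapply nd_eqE; eauto.
Qed.

Lemma nd_ren P l (G : list (form P)) A :
  nd l G A -> forall r, nd l (map (ren r) G) (ren r A).
Proof.
  assert (M : forall r (G : list (form P)),
            map (ren (up r)) (map shift G) = map shift (map (ren r) G)).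
  { intros r G0. rewrite !map_map. apply map_ext. intros B. apply ren_shift. }
  induction 1; intros r; cbn in *.
  - apply nd_hyp. apply in_map; assumption.
  - apply nd_botE; auto.
  - apply nd_dne; auto.
  - apply nd_andI; auto.
  - eapply nd_andE1; eauto.
  - eapply nd_andE2; eauto.
  - apply nd_orI1; auto.
  - apply nd_orI2; auto.
  - eapply nd_orE; eauto.
  - apply nd_impI; auto.
  - eapply nd_impE; eauto.
  - apply nd_allI. rewrite <- M. apply IHnd.
  - rewrite ren_inst. apply nd_allE. apply IHnd.
  - apply nd_exI with (r y). rewrite <- ren_inst. apply IHnd.
  - eapply nd_exE; [apply IHnd1|]. rewrite <- M, <- ren_shift. apply IHnd2.
  - apply nd_eqI.
  - rewrite ren_inst. eapply nd_eqE; [apply IHnd1|].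
    rewrite <- ren_inst. apply IHnd2.
Qed.

(** A variable occurring nowhere else is as good as the bound variable of the
    existential elimination rule: exchange it for that variable. *)
Lemma nd_ex_fresh P l (G : list (form P)) A y :
  (forall B, In B G -> closed_below y B) -> closed_below (S y) A ->
  nd l (inst A y :: G) Bot -> nd l (Ex A :: G) Bot.
Proof.
  intros HG HA H.
  set (r := fun n => if n =? y then 0 else S n).
  assert (Hr : forall k, k < y -> r k = S k).
  { intros k Hk. unfold r. destruct (Nat.eqb_spec k y); [lia|reflexivity]. }
  apply nd_exE with A; [apply nd_hyp; left; reflexivity|].
  apply nd_ren with (r := r) in H. cbn [map] in H.
  replace (ren r (inst A y)) with A in H.
  - replace (map (ren r) G) with (map shift G) in H.
    + eapply nd_weaken; [exact H|]. intros B [<-|HB]; [left; reflexivity|].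
      right; right; exact HB.
    + apply map_ext_in. intros B HB. unfold shift. symmetry.
      apply ren_ext_below with y; auto.
  - unfold inst. rewrite ren_ren. transitivity (ren (fun n => n) A).
    { symmetry; apply ren_id. }
    apply ren_ext_below with (S y); [assumption|].
    intros [|k] Hk.
    + unfold r. rewrite Nat.eqb_refl. reflexivity.
    + rewrite Hr by lia. reflexivity.
Qed.

Definition add {P} (G : form P -> Prop) (C B : form P) : Prop := G B \/ B = C.

Lemma provable_mono P l (G G' : form P -> Prop) A :
  (forall B, G B -> G' B) -> provable l G A -> provable l G' A.
Proof. intros H [L [HL HA]]. exists L. auto. Qed.

Lemma add_context P (G : form P -> Prop) C L :
  (forall B, In B L -> add G C B) ->
  exists L', (forall B, In B L' -> G B) /\ incl L (C :: L').
Proof.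
  induction L as [|B L IH]; intros H.
  - exists nil. split; [intros B []|intros B []].
  - destruct IH as [L' [HL' HI]]; [intros; apply H; right; assumption|].
    destruct (H B (or_introl eq_refl)) as [HB| ->].
    + exists (B :: L'). split.
      * intros E [<-|HE]; auto.
      * intros E [<-|HE]; [right; left; reflexivity|].
        destruct (HI E HE); [left|right; right]; assumption.
    + exists L'. split; [assumption|].
      intros E [<-|HE]; [left; reflexivity|apply HI; assumption].
Qed.

Lemma deduction P l (G : form P -> Prop) C A :
  provable l (add G C) A -> provable l G (Imp C A).
Proof.
  intros [L [HL H]]. destruct (add_context _ _ _ _ HL) as [L' [HL' HI]].
  exists L'. split; [assumption|]. apply nd_impI. eapply nd_weaken; eauto.
Qed.

(** * Completeness of classical logic *)

(** Equality is interpreted by identity, so that definable functions of the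
    model are functions; [term_model] is therefore a quotient. *)
Fixpoint sat {D} (mem : D -> D -> Prop) (r : nat -> D) (A : set_form) : Prop :=
  match A with
  | Bot => False
  | Mem x y => mem (r x) (r y)
  | Eq x y => r x = r y
  | Atom p _ => match p with end
  | And A B => sat mem r A /\ sat mem r B
  | Or A B => sat mem r A \/ sat mem r B
  | Imp A B => sat mem r A -> sat mem r B
  | All A => forall x, sat mem (scons x r) A
  | Ex A => exists x, sat mem (scons x r) A
  end.

Definition consistent (G : set_form -> Prop) : Prop := ~ provable classical G Bot.

Definition bounded_by (G : set_form -> Prop) (y : nat) : Prop :=
  forall B, G B -> closed_below y B.

Fixpoint code (A : set_form) : nat :=
  match A with
  | Bot => to_nat (0, 0)
  | Mem x y => to_nat (1, to_nat (x, y))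
  | Eq x y => to_nat (2, to_nat (x, y))
  | Atom p _ => match p with end
  | And A B => to_nat (3, to_nat (code A, code B))
  | Or A B => to_nat (4, to_nat (code A, code B))
  | Imp A B => to_nat (5, to_nat (code A, code B))
  | All A => to_nat (6, code A)
  | Ex A => to_nat (7, code A)
  end.

Lemma code_inj : forall A B, code A = code B -> A = B.
Proof.
  induction A; destruct B; cbn [code]; intros H; try destruct p;
    apply to_nat_inj in H; try discriminate H; try reflexivity;
    apply pair_equal_spec in H; destruct H as [_ H];
    try (apply to_nat_inj, pair_equal_spec in H; destruct H as [H1 H2]);
    f_equal; auto.
Qed.

(** Only applied to sets of formulas with a common bound on their variables. *)
Definition fresh (G : set_form -> Prop) : nat := epsilon (inhabits 0) (bounded_by G).

(** Henkin's step: the variables of the language serve as the constants that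
    witness existential formulas. *)
Definition extend (G : set_form -> Prop) (C B : set_form) : Prop :=
  G B \/ consistent (add G C) /\
         (B = C \/ exists E, C = Ex E /\ B = inst E (fresh (add G C))).

Lemma fresh_bounds G C b : bounded_by G b -> bounded_by (add G C) (fresh (add G C)).
Proof.
  intros H. unfold fresh. apply epsilon_spec. destruct (closed_below_exists _ C) as [n Hn].
  exists (b + n). intros B [HB| ->].
  - eapply closed_below_le; [|apply H; exact HB]; lia.
  - eapply closed_below_le; [|exact Hn]; lia.
Qed.

(** The theory contains only sentences and each stage adds at most two
    formulas, so there is always a variable left to serve as a witness. *)
Lemma extend_bounded G C b : bounded_by G b -> exists b', bounded_by (extend G C) b'.
Proof.
  intros H. pose proof (fresh_bounds G C b H) as HF.
  exists (S (fresh (add G C))). intros B [HB|[_ [->|[E [-> ->]]]]].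
  - eapply closed_below_le; [|apply HF; left; assumption]; lia.
  - eapply closed_below_le; [|apply HF; right; reflexivity]; lia.
  - apply closed_below_ren with (S (fresh (add G (Ex E)))).
    + apply (HF (Ex E)). right; reflexivity.
    + intros [|k]; lia.
Qed.

Lemma extend_consistent G C b :
  bounded_by G b -> consistent G -> consistent (extend G C).
Proof.
  intros Hb HG H. pose proof (fresh_bounds G C b Hb) as HF.
  destruct (classic (consistent (add G C))) as [Hc|Hc].
  - destruct (classic (exists E, C = Ex E)) as [[E ->]|HE].
    + assert (H' : provable classical (add (add G (Ex E)) (inst E (fresh (add G (Ex E))))) Bot).
      { eapply provable_mono; [|exact H].
        intros B [HB|[_ [->|[E' [HE ->]]]]].
        - left; left; assumption.
        - left; right; reflexivity.
        - injection HE as <-. right; reflexivity. }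
      destruct H' as [L [HL HB]].
      destruct (add_context _ _ _ _ HL) as [L' [HL' HI]].
      apply Hc. exists (Ex E :: L'). split.
      * intros B [<-|HB']; [right; reflexivity|auto].
      * apply nd_ex_fresh with (fresh (add G (Ex E))).
        -- intros B HB'. apply HF; auto.
        -- apply (HF (Ex E)). right; reflexivity.
        -- eapply nd_weaken; eauto.
    + apply Hc. eapply provable_mono; [|exact H].
      intros B [HB|[_ [->|[E [HE' _]]]]].
      * left; assumption.
      * right; reflexivity.
      * destruct HE; eauto.
  - apply HG. eapply provable_mono; [|exact H].
    intros B [HB|[HB _]]; [assumption|contradiction].
Qed.

Fixpoint stage (G : set_form -> Prop) (n : nat) : set_form -> Prop :=
  match n with
  | O => G
  | S n => fun B => stage G n B \/ exists C, code C = n /\ extend (stage G n) C B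
  end.

Definition completion (G : set_form -> Prop) (B : set_form) : Prop :=
  exists n, stage G n B.

Lemma stage_succ G n :
  (exists C, stage G (S n) = extend (stage G n) C) \/
  (forall B, stage G (S n) B -> stage G n B).
Proof.
  destruct (classic (exists C, code C = n)) as [[C HC]|H].
  - left. exists C. apply functional_extensionality; intros B.
    apply propositional_extensionality. split.
    + intros [HB|[C' [HC' HB]]]; [left; assumption|].
      rewrite (code_inj C C') by congruence. assumption.
    + intros HB. right; exists C; auto.
  - right. intros B [HB|[C [HC _]]]; [assumption|destruct H; eauto].
Qed.

Section Completion.

Variable G : set_form -> Prop.
Hypothesis G_bounded : exists b, bounded_by G b.
Hypothesis G_consistent : consistent G.

Lemma stage_consistent n :
  (exists b, bounded_by (stage G n) b) /\ consistent (stage G n).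
Proof.
  induction n as [|n [[b Hb] Hc]]; [auto|].
  destruct (stage_succ G n) as [[C ->]|H].
  - split; [eapply extend_bounded; eauto|eapply extend_consistent; eauto].
  - split; [exists b; intros B HB; auto|].
    intros HB. apply Hc. eapply provable_mono; eauto.
Qed.

Lemma stage_mono n m : n <= m -> forall B, stage G n B -> stage G m B.
Proof. induction 1; intros B HB; [assumption|left; auto]. Qed.

Lemma completion_consistent : consistent (completion G).
Proof.
  intros [L [HL H]].
  assert (HS : exists n, forall B, In B L -> stage G n B).
  { clear H. induction L as [|B L IH]; [exists 0; intros B []|].
    destruct IH as [n Hn]; [intros; apply HL; right; assumption|].
    destruct (HL B (or_introl eq_refl)) as [m Hm].
    exists (n + m). intros E [<-|HE].
    - eapply stage_mono; [|exact Hm]; lia.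
    - eapply stage_mono; [|apply Hn; exact HE]; lia. }
  destruct HS as [n Hn]. apply (proj2 (stage_consistent n)). exists L; auto.
Qed.

Lemma completion_extend B :
  consistent (add (completion G) B) -> completion G B /\
  forall E, B = Ex E -> exists y, completion G (inst E y).
Proof.
  intros H.
  assert (H' : consistent (add (stage G (code B)) B)).
  { intros HB. apply H. eapply provable_mono; [|exact HB].
    intros E [HE|HE]; [left; exists (code B); assumption|right; assumption]. }
  split.
  - exists (S (code B)). right; exists B. split; [reflexivity|]. right; auto.
  - intros E HE. exists (fresh (add (stage G (code B)) B)). exists (S (code B)).
    right; exists B. split; [reflexivity|]. right; split; eauto.
Qed.

Lemma completion_closed B : provable classical (completion G) B -> completion G B.
Proof.
  intros [L [HL HB]]. apply completion_extend. intros HC.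
  apply deduction in HC. destruct HC as [L' [HL' HC]].
  apply completion_consistent. exists (L ++ L'). split.
  - intros E HE. apply in_app_or in HE. destruct HE; auto.
  - apply nd_impE with B.
    + eapply nd_weaken; [exact HC|apply incl_appr, incl_refl].
    + eapply nd_weaken; [exact HB|apply incl_appl, incl_refl].
Qed.

Lemma completion_infer L B :
  nd classical L B -> (forall E, In E L -> completion G E) -> completion G B.
Proof. intros H HL. apply completion_closed. exists L; auto. Qed.

Lemma completion_neg B : completion G (Neg B) <-> ~ completion G B.
Proof.
  split.
  - intros H H'. apply completion_consistent. exists (Neg B :: B :: nil). split.
    + intros E [<-|[<-|[]]]; assumption.
    + apply nd_impE with B; apply nd_hyp; cbn; auto.
  - intros H. apply completion_closed, deduction. apply NNPP. intros HC.
    apply H, completion_extend. exact HC.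
Qed.

Lemma completion_ex A : completion G (Ex A) <-> exists y, completion G (inst A y).
Proof.
  split.
  - intros H. refine (proj2 (completion_extend (Ex A) _) A eq_refl).
    intros HB. apply completion_consistent. eapply provable_mono; [|exact HB].
    intros E [HE| ->]; assumption.
  - intros [y H]. apply (completion_infer (inst A y :: nil)).
    + apply nd_exI with y. apply nd_hyp; left; reflexivity.
    + intros E [<-|[]]; assumption.
Qed.

Lemma completion_imp A B :
  completion G (Imp A B) <-> (completion G A -> completion G B).
Proof.
  split.
  - intros H HA. apply (completion_infer (Imp A B :: A :: nil)).
    + apply nd_impE with A; apply nd_hyp; cbn; auto.
    + intros E [<-|[<-|[]]]; assumption.
  - intros H. destruct (classic (completion G A)) as [HA|HA].
    + apply (completion_infer (B :: nil)).
      * apply nd_impI, nd_hyp; cbn; auto.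
      * intros E [<-|[]]; auto.
    + apply completion_neg in HA. apply (completion_infer (Neg A :: nil)).
      * apply nd_impI, nd_botE. apply nd_impE with A; apply nd_hyp; cbn; auto.
      * intros E [<-|[]]; auto.
Qed.

Lemma completion_and A B :
  completion G (And A B) <-> completion G A /\ completion G B.
Proof.
  split.
  - intros H; split; apply (completion_infer (And A B :: nil)).
    + apply nd_andE1 with B, nd_hyp; left; reflexivity.
    + intros E [<-|[]]; assumption.
    + apply nd_andE2 with A, nd_hyp; left; reflexivity.
    + intros E [<-|[]]; assumption.
  - intros [HA HB]. apply (completion_infer (A :: B :: nil)).
    + apply nd_andI; apply nd_hyp; cbn; auto.
    + intros E [<-|[<-|[]]]; assumption.
Qed.

Lemma completion_or A B :
  completion G (Or A B) <-> completion G A \/ completion G B.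
Proof.
  split.
  - intros H. apply NNPP; intros HN. apply not_or_and in HN. destruct HN as [HA HB].
    apply completion_neg in HA, HB. apply completion_consistent.
    exists (Or A B :: Neg A :: Neg B :: nil). split.
    + intros E [<-|[<-|[<-|[]]]]; assumption.
    + apply nd_orE with A B; [apply nd_hyp; cbn; auto|..].
      * apply nd_impE with A; apply nd_hyp; cbn; auto.
      * apply nd_impE with B; apply nd_hyp; cbn; auto.
  - intros [H|H].
    + apply (completion_infer (A :: nil)).
      * apply nd_orI1, nd_hyp; left; reflexivity.
      * intros E [<-|[]]; assumption.
    + apply (completion_infer (B :: nil)).
      * apply nd_orI2, nd_hyp; left; reflexivity.
      * intros E [<-|[]]; assumption.
Qed.

Lemma inst_shift_zero P (A : form P) : inst (ren (up S) A) 0 = A.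
Proof.
  unfold inst. rewrite ren_ren.
  transitivity (ren (fun n => n) A); [|apply ren_id].
  f_equal. apply functional_extensionality; intros [|n]; reflexivity.
Qed.

Lemma completion_all A : completion G (All A) <-> forall y, completion G (inst A y).
Proof.
  split.
  - intros H y. apply (completion_infer (All A :: nil)).
    + apply nd_allE, nd_hyp; left; reflexivity.
    + intros E [<-|[]]; assumption.
  - intros H. apply NNPP; intros HN.
    destruct (classic (completion G (Ex (Neg A)))) as [HE|HE].
    + apply completion_ex in HE. destruct HE as [y HE].
      apply (completion_neg (inst A y)) in HE. auto.
    + apply HN. apply completion_neg in HE.
      apply (completion_infer (Neg (Ex (Neg A)) :: nil)).
      * apply nd_allI. apply nd_dne; [reflexivity|]. apply nd_impI.
        cbn. eapply nd_impE; [apply nd_hyp; right; left; reflexivity|].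
        apply nd_exI with 0. change (nd classical
          (Neg A :: Neg (ren S (Ex (Neg A))) :: nil) (Neg (inst (ren (up S) A) 0))).
        rewrite inst_shift_zero. apply nd_hyp; left; reflexivity.
      * intros E [<-|[]]; assumption.
Qed.

Definition same (n m : nat) : Prop := completion G (Eq n m).

Lemma same_subst A x y :
  same x y -> completion G (inst A x) -> completion G (inst A y).
Proof.
  intros H HA. apply (completion_infer (Eq x y :: inst A x :: nil)).
  - apply nd_eqE with x; apply nd_hyp; cbn; auto.
  - intros E [<-|[<-|[]]]; assumption.
Qed.

Lemma same_refl x : same x x.
Proof. apply (completion_infer nil); [apply nd_eqI|intros E []]. Qed.

Lemma same_sym x y : same x y -> same y x.
Proof.
  intros H. apply (same_subst (Eq 0 (S x)) x y H). apply same_refl.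
Qed.

Lemma same_trans x y z : same x y -> same y z -> same x z.
Proof. intros H H'. exact (same_subst (Eq (S x) 0) y z H' H). Qed.

Definition term_model : Type := {K : nat -> Prop | exists n, K = same n}.

Definition cls (n : nat) : term_model := exist _ (same n) (ex_intro _ n eq_refl).

Lemma cls_surj (x : term_model) : exists n, x = cls n.
Proof.
  destruct x as [K [n ->]]. exists n. reflexivity.
Qed.

Lemma cls_eq n m : cls n = cls m <-> same n m.
Proof.
  split.
  - intros H. assert (E : same n = same m) by exact (f_equal (@proj1_sig _ _) H).
    rewrite E. apply same_refl.
  - intros H.
    assert (E : same n = same m).
    { apply functional_extensionality; intros k. apply propositional_extensionality.
      split; intros Hk; eauto using same_trans, same_sym. }
    unfold cls. generalize (ex_intro (fun k => same m = same k) m eq_refl).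
    generalize (ex_intro (fun k => same n = same k) n eq_refl).
    rewrite E. intros p q. f_equal. apply proof_irrelevance.
Qed.

Definition term_mem (x y : term_model) : Prop :=
  exists n m, x = cls n /\ y = cls m /\ completion G (Mem n m).

(** The renaming [r] lets the induction pass through quantifiers: the value
    [cls n] of a bound variable is named by the variable [n]. *)
Lemma truth A : forall r,
  sat term_mem (fun n => cls (r n)) A <-> completion G (ren r A).
Proof.
  assert (SC : forall n r, scons (cls n) (fun k => cls (r k))
                           = fun k => cls (scons n r k)).
  { intros n r. apply functional_extensionality; intros [|k]; reflexivity. }
  assert (IN : forall (A : set_form) r n, inst (ren (up r) A) n = ren (scons n r) A).
  { intros A0 r n. unfold inst. rewrite ren_ren. f_equal.
    apply functional_extensionality; intros [|k]; reflexivity. }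
  induction A; intros r; cbn.
  - split; [intros []|]. intros H. apply completion_consistent.
    exists (Bot :: nil). split; [intros E [<-|[]]; assumption|].
    apply nd_hyp; left; reflexivity.
  - split.
    + intros [n [m [Hn [Hm H]]]]. apply cls_eq, same_sym in Hn, Hm.
      apply (same_subst (Mem (S (r x)) 0) m); [assumption|].
      apply (same_subst (Mem 0 (S m)) n); assumption.
    + intros H. exists (r x), (r y). auto.
  - apply cls_eq.
  - destruct p.
  - rewrite IHA1, IHA2, completion_and. reflexivity.
  - rewrite IHA1, IHA2, completion_or. reflexivity.
  - rewrite IHA1, IHA2, completion_imp. reflexivity.
  - rewrite completion_all. split.
    + intros H y. rewrite IN. apply IHA. rewrite <- SC. apply H.
    + intros H x. destruct (cls_surj x) as [n ->]. rewrite SC. apply IHA.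
      rewrite <- IN. apply H.
  - rewrite completion_ex. split.
    + intros [x H]. destruct (cls_surj x) as [n ->]. exists n. rewrite IN.
      apply IHA. rewrite <- SC. assumption.
    + intros [n H]. exists (cls n). rewrite SC. apply IHA. rewrite <- IN. assumption.
Qed.

End Completion.

Theorem completeness (T : set_form -> Prop) (A : set_form) :
  (forall B, T B -> sentence B) -> sentence A -> ~ provable classical T A ->
  exists (D : Type) (mem : D -> D -> Prop) (r : nat -> D),
    (forall B, provable classical T B -> sat mem r B) /\ ~ sat mem r A.
Proof.
  intros HT HA H. set (G := add T (Neg A)).
  assert (Gb : exists b, bounded_by G b).
  { exists 0. intros B [HB| ->]; [apply HT; assumption|]. split; [exact HA|exact I]. }
  assert (Gc : consistent G).
  { intros HB. apply H. apply deduction in HB. destruct HB as [L [HL HB]].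
    exists L. split; [assumption|]. apply nd_dne; [reflexivity|exact HB]. }
  exists (term_model G), (term_mem G), (fun n => cls G n). split.
  - intros B HB. apply (truth G Gb Gc B (fun n => n)). rewrite ren_id.
    apply (completion_closed G Gb Gc). eapply provable_mono; [|exact HB].
    intros E HE. exists 0. left; assumption.
  - intros HS. apply (truth G Gb Gc A (fun n => n)) in HS. rewrite ren_id in HS.
    revert HS. apply (completion_neg G Gb Gc). exists 0. right; reflexivity.
Qed.

(** * Relations definable in a model *)

Lemma sat_ren D (mem : D -> D -> Prop) A : forall f r,
  sat mem r (ren f A) <-> sat mem (fun n => r (f n)) A.
Proof.
  assert (U : forall x f (r : nat -> D), (fun n => scons x r (up f n)) = scons x (fun n => r (f n))).
  { intros. apply functional_extensionality; intros [|n]; reflexivity. }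
  induction A; intros f r; cbn; rewrite ?IHA1, ?IHA2; try reflexivity.
  - split; intros H x; specialize (H x); rewrite IHA, U in *; assumption.
  - split; intros [x H]; exists x; rewrite IHA, U in *; assumption.
Qed.

(** Whatever commutes with renaming depends on the free variables only: the
    variables from [n] on can be renamed to a single one, and choosing different
    targets for two valuations makes both factor through a third. *)
Lemma ext_below_of_ren P D (S : form P -> (nat -> D) -> Prop) :
  (forall A f r, S (ren f A) r <-> S A (fun n => r (f n))) ->
  forall A n r s, closed_below n A -> (forall k, k < n -> r k = s k) ->
  S A r <-> S A s.
Proof.
  intros HS A n r s Hc Hrs.
  set (f := fun m k => if k <? n then k else m).
  assert (Hf : forall m, ren (f m) A = A).
  { intros m. rewrite <- (ren_id _ A) at 2. apply ren_ext_below with n; [assumption|].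
    intros k Hk. unfold f. apply Nat.ltb_lt in Hk. rewrite Hk. reflexivity. }
  set (q := fun k => if k =? 1 + n then s n else r k).
  transitivity (S A q).
  - rewrite <- (Hf n), HS, HS.
    replace (fun k => q (f n k)) with (fun k => r (f n k)); [reflexivity|].
    apply functional_extensionality; intros k. unfold q, f.
    destruct (Nat.ltb_spec k n) as [Hk|Hk].
    + destruct (Nat.eqb_spec k (1 + n)); [lia|reflexivity].
    + destruct (Nat.eqb_spec n (1 + n)); [lia|reflexivity].
  - rewrite <- (Hf (1 + n)) at 1. rewrite <- (Hf n) at 2. rewrite HS, HS.
    replace (fun k => q (f (1 + n) k)) with (fun k => s (f n k)); [reflexivity|].
    apply functional_extensionality; intros k. unfold q, f.
    destruct (Nat.ltb_spec k n) as [Hk|Hk].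
    + destruct (Nat.eqb_spec k (1 + n)); [lia|symmetry; auto].
    + rewrite Nat.eqb_refl. reflexivity.
Qed.

Lemma sat_ext_below D (mem : D -> D -> Prop) A n r s :
  closed_below n A -> (forall k, k < n -> r k = s k) -> sat mem r A <-> sat mem s A.
Proof. apply (ext_below_of_ren _ _ (fun A r => sat mem r A)). intros; apply sat_ren. Qed.

Section Model.

Variables (D : Type) (mem : D -> D -> Prop).
Hypothesis mem_ext : forall x y, (forall z, mem z x <-> mem z y) -> x = y.
Hypothesis upair_exists : forall x y, exists z, forall t, mem t z <-> t = x \/ t = y.
Hypothesis union_exists : forall x, exists z, forall t,
  mem t z <-> exists u, mem u x /\ mem t u.
Hypothesis sat_foundation : forall (A : set_form) r,
  (forall x, (forall y, mem y x -> sat mem (scons y r) A) -> sat mem (scons x r) A) ->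
  forall x, sat mem (scons x r) A.
Variable inhabitant : D.

(** A definition has no parameters of its own, but all variables beyond
    the intended arguments of [R] are available as parameters. *)
Definition definable (R : (nat -> D) -> Prop) : Prop :=
  exists A, forall r, sat mem r A <-> R r.

Lemma definable_iff R R' : (forall r, R r <-> R' r) -> definable R -> definable R'.
Proof. intros H [A HA]. exists A. intros r. rewrite HA. apply H. Qed.

Lemma definable_ren R f : definable R -> definable (fun r => R (fun n => r (f n))).
Proof. intros [A HA]. exists (ren f A). intros r. rewrite sat_ren. apply HA. Qed.

Lemma definable_false : definable (fun _ => False).
Proof. exists Bot. reflexivity. Qed.

Lemma definable_true : definable (fun _ => True).
Proof. exists (Imp Bot Bot). cbn. tauto. Qed.

Lemma definable_and R S : definable R -> definable S -> definable (fun r => R r /\ S r).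
Proof. intros [A HA] [B HB]. exists (And A B). intros r; cbn. rewrite HA, HB. reflexivity. Qed.

Lemma definable_or R S : definable R -> definable S -> definable (fun r => R r \/ S r).
Proof. intros [A HA] [B HB]. exists (Or A B). intros r; cbn. rewrite HA, HB. reflexivity. Qed.

Lemma definable_imp R S : definable R -> definable S -> definable (fun r => R r -> S r).
Proof. intros [A HA] [B HB]. exists (Imp A B). intros r; cbn. rewrite HA, HB. reflexivity. Qed.

Lemma definable_all_scons R : definable R -> definable (fun r => forall x, R (scons x r)).
Proof.
  intros [A HA]. exists (All A). intros r; cbn.
  split; intros H x; apply HA; apply H.
Qed.

Lemma definable_all (R : D -> (nat -> D) -> Prop) :
  definable (fun r => R (r 0) (fun n => r (S n))) -> definable (fun r => forall x, R x r).
Proof. intros H. exact (definable_all_scons _ H). Qed.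

Lemma definable_ex (R : D -> (nat -> D) -> Prop) :
  definable (fun r => R (r 0) (fun n => r (S n))) -> definable (fun r => exists x, R x r).
Proof.
  intros [A HA]. exists (Ex A). intros r; cbn.
  split; intros [x H]; exists x; apply (HA (scons x r)); exact H.
Qed.

(** The graph is taken with the value as variable 0, before the arguments. *)
Definition definable_fun (t : (nat -> D) -> D) : Prop :=
  definable (fun r => r 0 = t (fun n => r (S n))).

Lemma definable_fun_var i : definable_fun (fun r => r i).
Proof. exists (Eq 0 (S i)). reflexivity. Qed.

Lemma definable_fun_ren t f :
  definable_fun t -> definable_fun (fun r => t (fun n => r (f n))).
Proof. exact (definable_ren _ (up f)). Qed.

(** Replace [R (t r) r] by the existence of an [x] on the graph of [t]
    with [R x r]. *)
Lemma definable_comp (R : D -> (nat -> D) -> Prop) t :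
  definable_fun t -> definable (fun r => R (r 0) (fun n => r (S n))) ->
  definable (fun r => R (t r) r).
Proof.
  intros Ht HR.
  apply definable_iff with (fun r => exists x, x = t r /\ R x r).
  - intros r. split; [intros [x [-> H]]; assumption|intros H; eauto].
  - apply definable_ex. apply definable_and; assumption.
Qed.

Definition definable2 (R : D -> D -> Prop) : Prop :=
  forall s t, definable_fun s -> definable_fun t -> definable (fun r => R (s r) (t r)).

Definition definable3 (R : D -> D -> D -> Prop) : Prop :=
  forall s t u, definable_fun s -> definable_fun t -> definable_fun u ->
  definable (fun r => R (s r) (t r) (u r)).

Lemma definable2_intro R : definable (fun r => R (r 0) (r 1)) -> definable2 R.
Proof.
  intros H s t Hs Ht.
  apply (definable_comp (fun x r => R x (t r)) s Hs).
  apply (definable_comp (fun y r => R (r 0) y) (fun r => t (fun n => r (S n)))).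
  - exact (definable_fun_ren t S Ht).
  - exact (definable_ren _ (fun n => match n with 0 => 1 | _ => 0 end) H).
Qed.

Lemma definable3_intro R : definable (fun r => R (r 0) (r 1) (r 2)) -> definable3 R.
Proof.
  intros H s t u Hs Ht Hu.
  apply (definable_comp (fun x r => R x (t r) (u r)) s Hs).
  apply (definable_comp (fun y r => R (r 0) y (u (fun n => r (S n)))) (fun r => t (fun n => r (S n)))).
  { exact (definable_fun_ren t S Ht). }
  apply (definable_comp (fun z r => R (r 1) (r 0) z) (fun r => u (fun n => r (S (S n))))).
  { exact (definable_fun_ren u (fun n => S (S n)) Hu). }
  exact (definable_ren _ (fun n => match n with 0 => 2 | 1 => 1 | _ => 0 end) H).
Qed.

Lemma definable_mem : definable2 mem.
Proof. apply definable2_intro. exists (Mem 0 1). reflexivity. Qed.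

Lemma definable_eq : definable2 eq.
Proof. apply definable2_intro. exists (Eq 0 1). reflexivity. Qed.

Lemma foundation_definable R : definable R -> forall r,
  (forall x, (forall y, mem y x -> R (scons y r)) -> R (scons x r)) ->
  forall x, R (scons x r).
Proof.
  intros [A HA] r H x. apply HA. apply sat_foundation. intros y Hy.
  apply HA, H. intros z Hz. apply HA; auto.
Qed.

(** * Pairs and numerals *)

Definition upair (x y : D) : D :=
  proj1_sig (constructive_indefinite_description _ (upair_exists x y)).

Lemma mem_upair x y t : mem t (upair x y) <-> t = x \/ t = y.
Proof. exact (proj2_sig (constructive_indefinite_description _ (upair_exists x y)) t). Qed.

Lemma upair_char x y z : z = upair x y <-> forall t, mem t z <-> t = x \/ t = y.
Proof.
  split; [intros -> t; apply mem_upair|].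
  intros H. apply mem_ext. intros t. rewrite H, mem_upair. reflexivity.
Qed.

(** Any definable injective pairing will do; this is Kuratowski's. *)
Definition pr (x y : D) : D := upair (upair x x) (upair x y).

Lemma upair_inj x y x' y' : upair x y = upair x' y' ->
  x = x' /\ y = y' \/ x = y' /\ y = x'.
Proof.
  intros H.
  assert (A : x = x' \/ x = y') by (apply mem_upair; rewrite <- H; apply mem_upair; auto).
  assert (B : y = x' \/ y = y') by (apply mem_upair; rewrite <- H; apply mem_upair; auto).
  assert (C : x' = x \/ x' = y) by (apply mem_upair; rewrite H; apply mem_upair; auto).
  assert (E : y' = x \/ y' = y) by (apply mem_upair; rewrite H; apply mem_upair; auto).
  intuition congruence.
Qed.

Lemma pr_inj x y x' y' : pr x y = pr x' y' -> x = x' /\ y = y'.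
Proof.
  intros H. apply upair_inj in H.
  destruct H as [[H1 H2]|[H1 H2]]; apply upair_inj in H1, H2; intuition congruence.
Qed.

(** If every set had an element, the empty class would be progressive. *)
Lemma empty_exists : exists z, forall t, ~ mem t z.
Proof.
  apply NNPP. intros H.
  apply (foundation_definable _ definable_false (fun _ => inhabitant)); [|exact inhabitant].
  intros x Hx. apply H. exists x. exact Hx.
Qed.

Definition empty : D := proj1_sig (constructive_indefinite_description _ empty_exists).

Lemma mem_empty t : ~ mem t empty.
Proof. exact (proj2_sig (constructive_indefinite_description _ empty_exists) t). Qed.

(** Zermelo's numerals, indexed by the numbers outside of the model; they are
    tags, and the model need not have a set of them. *)
Fixpoint num (n : nat) : D :=
  match n with O => empty | S n => upair (num n) (num n) end.

Lemma num_inj : forall n m, num n = num m -> n = m.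
Proof.
  induction n as [|n IH]; destruct m as [|m]; cbn; intros H.
  - reflexivity.
  - destruct (mem_empty (num m)). rewrite H. apply mem_upair; auto.
  - destruct (mem_empty (num n)). rewrite <- H. apply mem_upair; auto.
  - f_equal. apply IH. apply upair_inj in H. destruct H as [[H _]|[H _]]; assumption.
Qed.

Lemma definable_fun_upair s t : definable_fun s -> definable_fun t ->
  definable_fun (fun r => upair (s r) (t r)).
Proof.
  intros Hs Ht. unfold definable_fun.
  apply definable_iff with (fun r => forall x, mem x (r 0) <->
    x = s (fun n => r (S n)) \/ x = t (fun n => r (S n))).
  { intros r. rewrite upair_char. reflexivity. }
  apply definable_all.
  assert (Hs' := definable_fun_ren s (fun n => S (S n)) Hs).
  assert (Ht' := definable_fun_ren t (fun n => S (S n)) Ht).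
  assert (V := definable_fun_var).
  apply definable_and; apply definable_imp; try apply definable_or;
    try (apply (definable_mem _ _ (V 0) (V 1))); apply definable_eq; auto.
Qed.

Lemma definable_fun_pr s t : definable_fun s -> definable_fun t ->
  definable_fun (fun r => pr (s r) (t r)).
Proof. intros; apply definable_fun_upair; apply definable_fun_upair; assumption. Qed.

Lemma definable_fun_num n : definable_fun (fun _ => num n).
Proof.
  induction n as [|n IH]; cbn.
  - unfold definable_fun.
    apply definable_iff with (fun r => forall x, mem x (r 0) -> False).
    + intros r. split; [|intros ->; apply mem_empty].
      intros H. apply mem_ext. intros z. split; intros Hz; [destruct (H z Hz)|].
      destruct (mem_empty z Hz).
    + apply definable_all, definable_imp; [|apply definable_false].
      apply definable_mem; apply definable_fun_var.
  - apply definable_fun_upair; assumption.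
Qed.

Arguments num : simpl never.

Ltac definability :=
  cbn beta;
  lazymatch goal with
  | |- definable_fun (fun r => r ?i) => apply definable_fun_var
  | |- definable_fun (fun r => pr (@?s r) (@?t r)) =>
      apply (definable_fun_pr s t); definability
  | |- definable_fun (fun r => num ?n) => apply definable_fun_num
  | |- definable (fun r => @?A r /\ @?B r) => apply (definable_and A B); definability
  | |- definable (fun r => @?A r \/ @?B r) => apply (definable_or A B); definability
  | |- definable (fun r => exists x : D, @?A r x) =>
      apply (definable_ex (fun x r => A r x)); definability
  | |- definable (fun r => False) => apply definable_false
  | |- definable (fun r => True) => apply definable_true
  | |- definable (fun r => @?s r = @?t r) => apply (definable_eq s t); definability
  | |- definable (fun r => mem (@?s r) (@?t r)) => apply (definable_mem s t); definability
  | |- definable (fun r => ~ @?A r) =>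
      apply (definable_imp A (fun _ => False)); definability
  | H : definable2 ?R |- definable (fun r => ?R (@?s r) (@?t r)) =>
      apply (H s t); definability
  | H : definable3 ?R |- definable (fun r => ?R (@?s r) (@?t r) (@?u r)) =>
      apply (H s t u); definability
  | |- definable (fun r => forall x : D, @?A r x) =>
      apply (definable_all (fun x r => A r x)); definability
  | |- definable (fun r => @?A r -> @?B r) => apply (definable_imp A B); definability
  | _ => idtac
  end.

(** * Set-generated fixed points *)

(** The union of the sets [d] included in [F d]; this is definable, while
    the least fixed point of [F] need not be. *)
Definition fixpoint (F : (D -> Prop) -> D -> Prop) (x : D) : Prop :=
  exists d, mem x d /\ forall y, mem y d -> F (fun z => mem z d) y.

Definition monotone (F : (D -> Prop) -> D -> Prop) : Prop :=
  forall X Y x, (forall y, X y -> Y y) -> F X x -> F Y x.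

(** Finitely many premises are needed to combine the sets that witness
    them: the model satisfies union, but it need not satisfy replacement. *)
Definition finitary (F : (D -> Prop) -> D -> Prop) : Prop :=
  forall X x, F X x -> exists l, (forall y, In y l -> X y) /\ F (fun y => In y l) x.

Lemma mem_union2 x y : exists z, forall t, mem t z <-> mem t x \/ mem t y.
Proof.
  destruct (union_exists (upair x y)) as [z Hz]. exists z. intros t. rewrite Hz. split.
  - intros [u [Hu Ht]]. apply mem_upair in Hu. destruct Hu as [->| ->]; auto.
  - intros [H|H]; [exists x|exists y]; split; auto; apply mem_upair; auto.
Qed.

(** From right to left, add [x] to the union of the sets that witness its
    finitely many premises. *)
Lemma fixpoint_unfold F : monotone F -> finitary F ->
  forall x, fixpoint F x <-> F (fixpoint F) x.
Proof.
  intros HM HF x. split.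
  - intros [d [Hx Hd]]. apply HM with (fun z => mem z d); [|auto].
    intros y Hy. exists d; auto.
  - intros H. apply HF in H. destruct H as [l [Hl H]].
    assert (HD : exists d, (forall y, In y l -> mem y d) /\
                      forall y, mem y d -> F (fun z => mem z d) y).
    { clear H. induction l as [|y l IH].
      - exists empty. split; [intros y []|]. intros y Hy. destruct (mem_empty y Hy).
      - destruct IH as [d [Hd Hd']]; [intros; apply Hl; right; assumption|].
        destruct (Hl y (or_introl eq_refl)) as [e [He He']].
        destruct (mem_union2 d e) as [u Hu]. exists u. split.
        + intros z [<-|Hz]; apply Hu; auto.
        + intros z Hz. apply Hu in Hz. destruct Hz as [Hz|Hz].
          * apply HM with (fun z => mem z d); [|auto]. intros; apply Hu; auto.
          * apply HM with (fun z => mem z e); [|auto]. intros; apply Hu; auto. }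
    destruct HD as [d [Hd Hd']]. destruct (mem_union2 d (upair x x)) as [u Hu].
    exists u. split; [apply Hu; right; apply mem_upair; auto|].
    intros z Hz. apply Hu in Hz. destruct Hz as [Hz|Hz].
    + apply HM with (fun z => mem z d); [|auto]. intros; apply Hu; auto.
    + apply mem_upair in Hz. assert (z = x) as -> by tauto.
      apply HM with (fun y => In y l); [|auto]. intros; apply Hu; auto.
Qed.

Lemma definable_fixpoint F :
  definable (fun r => F (fun z => mem z (r 0)) (r 1)) ->
  definable (fun r => fixpoint F (r 0)).
Proof.
  intros H.
  assert (H2 : definable2 (fun d y => F (fun z => mem z d) y)) by (apply definable2_intro, H).
  unfold fixpoint. definability.
  apply (H2 (fun r => r 1) (fun r => r 0)); definability.
Qed.

(** * A nondeterministic applicative structure *)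

Section Application.

Variable oracle : D -> D -> D -> Prop.
Hypothesis definable_oracle : definable3 oracle.

(** A code is a pair of a tag and a parameter.  The clauses for [tag_pair],
    [tag_app], [tag_id] and [tag_const] are those that abstraction needs;
    [tag_pair] and [tag_app] combine the results of two codes on the same
    argument.  [tag_case] and [tag_split] analyse an argument that is a pair. *)
Definition tag_pair := 0.
Definition tag_app := 1.
Definition tag_id := 2.
Definition tag_const := 3.
Definition tag_case := 4.
Definition tag_split := 5.
Definition tag_oracle := 6.

Hypothesis oracle_tag : forall t c v, oracle t c v -> exists n, t = num (tag_oracle + n).

(** One unfolding of the application relation, with [X] for the results of the
    subcomputations.  There may be several values or none. *)
Definition step (X : D -> D -> D -> Prop) (e c v : D) : Prop :=
  exists t p, e = pr t p /\
  (t = num tag_pair /\ (exists a b u w, p = pr a b /\ X a c u /\ X b c w /\ v = pr u w) \/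
   t = num tag_app /\ (exists a b u w, p = pr a b /\ X a c u /\ X b c w /\ X u w v) \/
   t = num tag_id /\ v = c \/
   t = num tag_const /\ v = p \/
   t = num tag_case /\ (exists a b x, p = pr a b /\
     (c = pr (num 0) x /\ X a x v \/ c = pr (num 1) x /\ X b x v)) \/
   t = num tag_split /\ (exists x k u, c = pr x k /\ X p x u /\ X u k v) \/
   oracle t c v).

Definition graph (X : D -> Prop) (e c v : D) : Prop := X (pr e (pr c v)).

Definition app_operator (X : D -> Prop) (x : D) : Prop :=
  exists e c v, x = pr e (pr c v) /\ step (graph X) e c v.

Definition app : D -> D -> D -> Prop := graph (fixpoint app_operator).

Lemma step_monotone (X Y : D -> D -> D -> Prop) e c v :
  (forall a b u, X a b u -> Y a b u) -> step X e c v -> step Y e c v.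
Proof.
  intros H [t [p [He Hs]]]. exists t, p. split; [assumption|].
  destruct Hs as [[Ht (a & b & u & w & Hp & H1 & H2 & Hv)]|
    [[Ht (a & b & u & w & Hp & H1 & H2 & H3)]|
    [Hs|[Hs|[[Ht (a & b & x & Hp & Hs)]|
    [[Ht (x & k & u & Hc & H1 & H2)]|Hs]]]]]].
  - left. split; [assumption|]. exists a, b, u, w. auto 10.
  - right; left. split; [assumption|]. exists a, b, u, w. auto 10.
  - right; right; left. assumption.
  - right; right; right; left. assumption.
  - right; right; right; right; left. split; [assumption|]. exists a, b, x.
    split; [assumption|]. destruct Hs as [[Hc Hs]|[Hc Hs]]; auto.
  - do 5 right. left. split; [assumption|]. exists x, k, u. auto.
  - do 6 right. assumption.
Qed.

Lemma step_finitary (X : D -> Prop) e c v : step (graph X) e c v ->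
  exists l, (forall y, In y l -> X y) /\ step (graph (fun y => In y l)) e c v.
Proof.
  intros [t [p [He Hs]]].
  destruct Hs as [[Ht (a & b & u & w & Hp & H1 & H2 & Hv)]|
    [[Ht (a & b & u & w & Hp & H1 & H2 & H3)]|
    [Hs|[Hs|[[Ht (a & b & x & Hp & Hs)]|
    [[Ht (x & k & u & Hc & H1 & H2)]|Hs]]]]]].
  - exists (pr a (pr c u) :: pr b (pr c w) :: nil). split.
    { intros y [<-|[<-|[]]]; assumption. }
    exists t, p. split; [assumption|]. left. split; [assumption|].
    exists a, b, u, w. unfold graph; cbn; auto 20.
  - exists (pr a (pr c u) :: pr b (pr c w) :: pr u (pr w v) :: nil). split.
    { intros y [<-|[<-|[<-|[]]]]; assumption. }
    exists t, p. split; [assumption|]. right; left. split; [assumption|].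
    exists a, b, u, w. unfold graph; cbn; auto 20.
  - exists nil. split; [intros y []|]. exists t, p. split; [assumption|].
    right; right; left. assumption.
  - exists nil. split; [intros y []|]. exists t, p. split; [assumption|].
    right; right; right; left. assumption.
  - destruct Hs as [[Hc Hs]|[Hc Hs]].
    + exists (pr a (pr x v) :: nil). split; [intros y [<-|[]]; assumption|].
      exists t, p. split; [assumption|]. right; right; right; right; left.
      split; [assumption|]. exists a, b, x. unfold graph; cbn; auto 20.
    + exists (pr b (pr x v) :: nil). split; [intros y [<-|[]]; assumption|].
      exists t, p. split; [assumption|]. right; right; right; right; left.
      split; [assumption|]. exists a, b, x. unfold graph; cbn; auto 20.
  - exists (pr p (pr x u) :: pr u (pr k v) :: nil). split.
    { intros y [<-|[<-|[]]]; assumption. }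
    exists t, p. split; [assumption|]. do 5 right. left. split; [assumption|].
    exists x, k, u. unfold graph; cbn; auto 20.
  - exists nil. split; [intros y []|]. exists t, p. split; [assumption|].
    do 6 right. assumption.
Qed.

Lemma app_unfold e c v : app e c v <-> step app e c v.
Proof.
  unfold app at 1, graph. rewrite fixpoint_unfold.
  - split.
    + intros (e' & c' & v' & H & Hs). apply pr_inj in H. destruct H as [<- H].
      apply pr_inj in H. destruct H as [<- <-]. exact Hs.
    + intros H. exists e, c, v. auto.
  - intros X Y x H (e' & c' & v' & Hx & Hs). exists e', c', v'. split; [assumption|].
    eapply step_monotone; [|exact Hs]. unfold graph; auto.
  - intros X x (e' & c' & v' & Hx & Hs). apply step_finitary in Hs.
    destruct Hs as [l [Hl Hs]]. exists l. split; [assumption|]. exists e', c', v'. auto.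
Qed.

Lemma definable_app : definable3 app.
Proof.
  assert (F : definable2 (fun d x => app_operator (fun z => mem z d) x)).
  { apply definable2_intro. unfold app_operator, step, graph. definability. }
  assert (H : definable (fun r => fixpoint app_operator (r 0))).
  { apply definable_fixpoint. apply (F (fun r => r 0) (fun r => r 1)); definability. }
  intros s t u Hs Ht Hu.
  apply (definable_comp (fun x _ => fixpoint app_operator x)
    (fun r => pr (s r) (pr (t r) (u r)))).
  - apply (definable_fun_pr s (fun r => pr (t r) (u r))); [assumption|].
    apply definable_fun_pr; assumption.
  - exact H.
Qed.

Ltac invert_app :=
  intros H; apply app_unfold in H; destruct H as [t [p' [He Hs]]];
  apply pr_inj in He; destruct He as [<- <-];
  destruct Hs as [[Ht Hs]|[[Ht Hs]|[[Ht Hs]|[[Ht Hs]|[[Ht Hs]|[[Ht Hs]|Hs]]]]]];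
  try (apply num_inj in Ht; discriminate Ht);
  try (destruct (oracle_tag _ _ _ Hs) as [n Ht]; apply num_inj in Ht;
       discriminate Ht).

Lemma app_pair a b c v : app (pr (num tag_pair) (pr a b)) c v <->
  exists u w, app a c u /\ app b c w /\ v = pr u w.
Proof.
  split.
  - invert_app. destruct Hs as (a' & b' & u & w & Hp & Hs).
    apply pr_inj in Hp. destruct Hp as [<- <-]. eauto.
  - intros (u & w & H). apply app_unfold. do 2 eexists. split; [reflexivity|].
    left. split; [reflexivity|]. exists a, b, u, w. auto 10.
Qed.

Lemma app_app a b c v : app (pr (num tag_app) (pr a b)) c v <->
  exists u w, app a c u /\ app b c w /\ app u w v.
Proof.
  split.
  - invert_app. destruct Hs as (a' & b' & u & w & Hp & Hs).
    apply pr_inj in Hp. destruct Hp as [<- <-]. eauto.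
  - intros (u & w & H). apply app_unfold. do 2 eexists. split; [reflexivity|].
    right; left. split; [reflexivity|]. exists a, b, u, w. auto 10.
Qed.

Lemma app_id p c v : app (pr (num tag_id) p) c v <-> v = c.
Proof.
  split; [invert_app; assumption|].
  intros ->. apply app_unfold. do 2 eexists. split; [reflexivity|]. auto 20.
Qed.

Lemma app_const p c v : app (pr (num tag_const) p) c v <-> v = p.
Proof.
  split; [invert_app; assumption|].
  intros ->. apply app_unfold. do 2 eexists. split; [reflexivity|]. auto 20.
Qed.

Lemma app_case_left a b x v :
  app (pr (num tag_case) (pr a b)) (pr (num 0) x) v <-> app a x v.
Proof.
  split.
  - invert_app. destruct Hs as (a' & b' & y & Hp & [[Hc Hs]|[Hc Hs]]);
      apply pr_inj in Hp, Hc; destruct Hp as [<- <-], Hc as [Hn <-]; [assumption|].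
    apply num_inj in Hn. discriminate.
  - intros H. apply app_unfold. do 2 eexists. split; [reflexivity|].
    do 4 right. left. split; [reflexivity|]. exists a, b, x. auto.
Qed.

Lemma app_case_right a b x v :
  app (pr (num tag_case) (pr a b)) (pr (num 1) x) v <-> app b x v.
Proof.
  split.
  - invert_app. destruct Hs as (a' & b' & y & Hp & [[Hc Hs]|[Hc Hs]]);
      apply pr_inj in Hp, Hc; destruct Hp as [<- <-], Hc as [Hn <-]; [|assumption].
    apply num_inj in Hn. discriminate.
  - intros H. apply app_unfold. do 2 eexists. split; [reflexivity|].
    do 4 right. left. split; [reflexivity|]. exists a, b, x. auto.
Qed.

Lemma app_split p x k v :
  app (pr (num tag_split) p) (pr x k) v <-> exists u, app p x u /\ app u k v.
Proof.
  split.
  - invert_app. destruct Hs as (x' & k' & u & Hc & Hs).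
    apply pr_inj in Hc. destruct Hc as [<- <-]. eauto.
  - intros (u & H). apply app_unfold. do 2 eexists. split; [reflexivity|].
    do 5 right. left. split; [reflexivity|]. exists x, k, u. auto.
Qed.

Lemma app_oracle n p c v :
  app (pr (num (tag_oracle + n)) p) c v <-> oracle (num (tag_oracle + n)) c v.
Proof.
  split; [invert_app; assumption|].
  intros H. apply app_unfold. do 2 eexists. split; [reflexivity|]. auto 20.
Qed.

(** * Programs *)

(** Programs live outside of the model; their values are elements of it.
    [PVar] is for the individual variables of a formula, [HVar] for
    the realizers of the hypotheses of a derivation. *)
Inductive program : Type :=
| PVar (n : nat)
| HVar (n : nat)
| Num (n : nat)
| Pair (s t : program)
| App (s t : program).

Fixpoint eval (r h : nat -> D) (t : program) (v : D) : Prop :=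
  match t with
  | PVar n => v = r n
  | HVar n => v = h n
  | Num n => v = num n
  | Pair s t => exists a b, eval r h s a /\ eval r h t b /\ v = pr a b
  | App s t => exists a b, eval r h s a /\ eval r h t b /\ app a b v
  end.

Definition PConst (t : program) : program := Pair (Num tag_const) t.
Definition PId : program := Pair (Num tag_id) (Num 0).

(** Abstraction of the individual variable 0, by the translation of lambda
    terms to combinators.  An abstraction always has exactly one
    value, even if its body has none, since the body is not evaluated. *)
Fixpoint lam_set (t : program) : program :=
  match t with
  | PVar 0 => PId
  | PVar (S n) => PConst (PVar n)
  | HVar n => PConst (HVar n)
  | Num n => PConst (Num n)
  | Pair s t => Pair (Num tag_pair) (Pair (lam_set s) (lam_set t))
  | App s t => Pair (Num tag_app) (Pair (lam_set s) (lam_set t))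
  end.

Fixpoint lam_hyp (t : program) : program :=
  match t with
  | PVar n => PConst (PVar n)
  | HVar 0 => PId
  | HVar (S n) => PConst (HVar n)
  | Num n => PConst (Num n)
  | Pair s t => Pair (Num tag_pair) (Pair (lam_hyp s) (lam_hyp t))
  | App s t => Pair (Num tag_app) (Pair (lam_hyp s) (lam_hyp t))
  end.

(** For [F] the set of values of a program: the sole value is a code of the
    multivalued function [f]. *)
Definition closure (F : D -> Prop) (f : D -> D -> Prop) : Prop :=
  exists e, (forall v, F v <-> v = e) /\ forall c v, app e c v <-> f c v.

Lemma closure_const r h t a : (forall v, eval r h t v <-> v = a) ->
  closure (eval r h (PConst t)) (fun _ v => v = a).
Proof.
  intros H. exists (pr (num tag_const) a). split; [|intros; apply app_const].
  intros v. cbn. split.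
  - intros (x & y & -> & Hy & ->). apply H in Hy. subst; reflexivity.
  - intros ->. exists (num tag_const), a. split; [reflexivity|]. split; [|reflexivity].
    apply H. reflexivity.
Qed.

Lemma closure_id r h : closure (eval r h PId) (fun c v => v = c).
Proof.
  exists (pr (num tag_id) (num 0)). split; [|intros; apply app_id].
  intros v. cbn. split; [intros (x & y & -> & -> & ->); reflexivity|].
  intros ->. eauto.
Qed.

Lemma closure_binary r h n s t f g k :
  (forall a b c v, app (pr (num n) (pr a b)) c v <->
     exists u w, app a c u /\ app b c w /\ k u w v) ->
  closure (eval r h s) f -> closure (eval r h t) g ->
  closure (eval r h (Pair (Num n) (Pair s t)))
    (fun c v => exists u w, f c u /\ g c w /\ k u w v).
Proof.
  intros HK (d & Hd & Hd') (e & He & He'). exists (pr (num n) (pr d e)). split.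
  - intros v. cbn. split.
    + intros (x & y & -> & (x' & y' & Hx & Hy & ->) & ->).
      apply Hd in Hx. apply He in Hy. subst; reflexivity.
    + intros ->. exists (num n), (pr d e). split; [reflexivity|]. split; [|reflexivity].
      exists d, e. rewrite Hd, He. auto.
  - intros c v. rewrite HK. split; intros (u & w & H1 & H2 & H3); exists u, w.
    + rewrite <- Hd', <- He'. auto.
    + rewrite Hd', He'. auto.
Qed.

Lemma closure_lam_set r h t :
  closure (eval r h (lam_set t)) (fun c => eval (scons c r) h t).
Proof.
  induction t as [[|n]|n|n|s IHs t IHt|s IHs t IHt].
  - exact (closure_id r h).
  - apply (closure_const r h (PVar n) (r n)); reflexivity.
  - apply (closure_const r h (HVar n) (h n)); reflexivity.
  - apply (closure_const r h (Num n) (num n)); reflexivity.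
  - exact (closure_binary r h tag_pair (lam_set s) (lam_set t) _ _ (fun u w v => v = pr u w) app_pair IHs IHt).
  - exact (closure_binary r h tag_app (lam_set s) (lam_set t) _ _ (fun u w v => app u w v) app_app IHs IHt).
Qed.

Lemma closure_lam_hyp r h t :
  closure (eval r h (lam_hyp t)) (fun c => eval r (scons c h) t).
Proof.
  induction t as [n|[|n]|n|s IHs t IHt|s IHs t IHt].
  - apply (closure_const r h (PVar n) (r n)); reflexivity.
  - exact (closure_id r h).
  - apply (closure_const r h (HVar n) (h n)); reflexivity.
  - apply (closure_const r h (Num n) (num n)); reflexivity.
  - exact (closure_binary r h tag_pair (lam_hyp s) (lam_hyp t) _ _ (fun u w v => v = pr u w) app_pair IHs IHt).
  - exact (closure_binary r h tag_app (lam_hyp s) (lam_hyp t) _ _ (fun u w v => app u w v) app_app IHs IHt).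
Qed.

(** At least one value, and all values as desired: partial correctness for all
    runs, termination for some run.  As programs are evaluated by value, this
    is preserved by application. *)
Definition good (F P : D -> Prop) : Prop := (exists v, F v) /\ forall v, F v -> P v.

Lemma good_mono F (P Q : D -> Prop) : (forall v, P v -> Q v) -> good F P -> good F Q.
Proof. intros H [HF HP]. split; auto. Qed.

Lemma good_iff F G P : (forall v, F v <-> G v) -> good F P <-> good G P.
Proof.
  intros H. split; intros [[v Hv] HP]; (split; [exists v; apply H; assumption|]);
    intros u Hu; apply HP, H; assumption.
Qed.

Lemma good_value (P : D -> Prop) a : P a -> good (fun v => v = a) P.
Proof. intros H. split; [eauto|]. intros v ->. assumption. Qed.

Lemma good_inhabited F P : good F P -> exists v, P v.
Proof. intros [[v Hv] H]; eauto. Qed.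

Lemma good_closure F f (P : D -> Prop) : closure F f ->
  (forall e, (forall c v, app e c v <-> f c v) -> P e) -> good F P.
Proof.
  intros (e & He & He') H. split.
  - exists e. apply He. reflexivity.
  - intros v Hv. apply He in Hv. subst. auto.
Qed.

Lemma good_pair r h s t (P Q R : D -> Prop) :
  good (eval r h s) P -> good (eval r h t) Q ->
  (forall a b, P a -> Q b -> R (pr a b)) -> good (eval r h (Pair s t)) R.
Proof.
  intros [[a Ha] HP] [[b Hb] HQ] H. split.
  - exists (pr a b). cbn. eauto.
  - intros v (x & y & Hx & Hy & ->). auto.
Qed.

Lemma good_app r h s t (P Q R : D -> Prop) :
  good (eval r h s) P -> good (eval r h t) Q ->
  (forall a b, P a -> Q b -> good (app a b) R) -> good (eval r h (App s t)) R.
Proof.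
  intros [[a Ha] HP] [[b Hb] HQ] H. split.
  - destruct (H a b (HP a Ha) (HQ b Hb)) as [[v Hv] _]. exists v. cbn. eauto.
  - intros v (x & y & Hx & Hy & Hv). apply (H x y); auto.
Qed.

Definition case_of (s t u : program) : program :=
  App (Pair (Num tag_case) (Pair (lam_hyp t) (lam_hyp u))) s.

Lemma good_case r h s t u (P Q R : D -> Prop) :
  good (eval r h s) (fun v => exists a, v = pr (num 0) a /\ P a \/ v = pr (num 1) a /\ Q a) ->
  (forall a, P a -> good (eval r (scons a h) t) R) ->
  (forall a, Q a -> good (eval r (scons a h) u) R) ->
  good (eval r h (case_of s t u)) R.
Proof.
  intros Hs Ht Hu.
  destruct (closure_lam_hyp r h t) as (d & Hd & Hd').
  destruct (closure_lam_hyp r h u) as (e & He & He').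
  apply good_app with (P := fun v => v = pr (num tag_case) (pr d e)) (Q := fun v =>
    exists a, v = pr (num 0) a /\ P a \/ v = pr (num 1) a /\ Q a).
  - apply good_pair with (P := fun v => v = num tag_case) (Q := fun v => v = pr d e).
    + apply good_value; reflexivity.
    + apply good_pair with (P := fun v => v = d) (Q := fun v => v = e).
      * apply (good_iff _ _ _ Hd), good_value; reflexivity.
      * apply (good_iff _ _ _ He), good_value; reflexivity.
      * intros ? ? -> ->; reflexivity.
    + intros ? ? -> ->; reflexivity.
  - assumption.
  - intros ? b -> [a [[-> Ha]|[-> Ha]]].
    + apply (good_iff _ (eval r (scons a h) t)); [|auto].
      intros v. rewrite app_case_left. apply Hd'.
    + apply (good_iff _ (eval r (scons a h) u)); [|auto].
      intros v. rewrite app_case_right. apply He'.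
Qed.

Definition split_pair (s t : program) : program :=
  App (Pair (Num tag_split) (lam_set (lam_hyp t))) s.

Lemma good_split r h s t (P : D -> D -> Prop) (R : D -> Prop) :
  good (eval r h s) (fun v => exists a b, v = pr a b /\ P a b) ->
  (forall a b, P a b -> good (eval (scons a r) (scons b h) t) R) ->
  good (eval r h (split_pair s t)) R.
Proof.
  intros Hs Ht.
  destruct (closure_lam_set r h (lam_hyp t)) as (e & He & He').
  apply good_app with (P := fun v => v = pr (num tag_split) e)
    (Q := fun v => exists a b, v = pr a b /\ P a b).
  - apply good_pair with (P := fun v => v = num tag_split) (Q := fun v => v = e).
    + apply good_value; reflexivity.
    + apply (good_iff _ _ _ He), good_value; reflexivity.
    + intros ? ? -> ->; reflexivity.
  - assumption.
  - intros ? c -> (a & b & -> & Hab).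
    destruct (closure_lam_hyp (scons a r) h t) as (d & Hd & Hd').
    apply (good_iff _ (eval (scons a r) (scons b h) t)); [|auto].
    intros v. rewrite app_split, <- Hd'. split.
    + intros (u & Hu & Hv). apply He', Hd in Hu. subst; assumption.
    + intros Hv. exists d. split; [|assumption]. apply He', Hd. reflexivity.
Qed.

(** * Realizability *)

(** [RQ h x] is to say that [h] realizes [Q x].  Formulas without [Q] are
    treated like the others, which keeps the soundness proof uniform. *)
Fixpoint realizes (RQ : D -> D -> Prop) (A : Q_form) (r : nat -> D) (h : D) : Prop :=
  match A with
  | Bot => False
  | Mem x y => mem (r x) (r y)
  | Eq x y => r x = r y
  | Atom _ x => RQ h (r x)
  | And A B => exists a b, h = pr a b /\ realizes RQ A r a /\ realizes RQ B r b
  | Or A B => exists a, h = pr (num 0) a /\ realizes RQ A r a \/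
                        h = pr (num 1) a /\ realizes RQ B r a
  | Imp A B => forall a, realizes RQ A r a -> good (app h a) (realizes RQ B r)
  | All A => forall x, good (app h x) (realizes RQ A (scons x r))
  | Ex A => exists x a, h = pr x a /\ realizes RQ A (scons x r) a
  end.

Lemma realizes_ren RQ A : forall f r h,
  realizes RQ (ren f A) r h <-> realizes RQ A (fun n => r (f n)) h.
Proof.
  assert (U : forall x f (r : nat -> D),
            (fun n => scons x r (up f n)) = scons x (fun n => r (f n))).
  { intros. apply functional_extensionality; intros [|n]; reflexivity. }
  induction A; intros f r h; cbn; try reflexivity.
  - split; intros (a & b & H); exists a, b; rewrite IHA1, IHA2 in *; assumption.
  - split; intros (a & H); exists a; rewrite IHA1, IHA2 in *; assumption.
  - split; intros H a Ha; (eapply good_mono; [|apply H, IHA1; exact Ha]);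
      intros v; apply IHA2.
  - split; intros H x; (eapply good_mono; [|apply H]);
      intros v Hv; [rewrite <- U; apply IHA|apply IHA; rewrite U]; assumption.
  - split; intros (x & a & H); exists x, a; rewrite IHA, U in *; assumption.
Qed.

Lemma realizes_ext_below RQ A n r s h :
  closed_below n A -> (forall k, k < n -> r k = s k) ->
  realizes RQ A r h <-> realizes RQ A s h.
Proof.
  apply (ext_below_of_ren _ _ (fun A r => realizes RQ A r h)).
  intros; apply realizes_ren.
Qed.

Lemma definable_at (F : (nat -> D) -> D -> Prop) :
  definable (fun r => F (fun n => r (S n)) (r 0)) ->
  forall f i, definable (fun r => F (fun n => r (f n)) (r i)).
Proof.
  intros H f i. exact (definable_ren _ (scons i f) H).
Qed.

Lemma definable_at_scons (F : (nat -> D) -> D -> Prop) :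
  definable (fun r => F (fun n => r (S n)) (r 0)) ->
  forall j f i, definable (fun r => F (scons (r j) (fun n => r (f n))) (r i)).
Proof.
  intros H j f i. apply definable_iff with (fun r => F (fun n => r (scons j f n)) (r i)).
  - intros r. replace (scons (r j) (fun n => r (f n))) with (fun n => r (scons j f n));
      [reflexivity|].
    apply functional_extensionality; intros [|n]; reflexivity.
  - apply definable_at. exact H.
Qed.

Lemma definable_realizes RQ : definable2 RQ -> forall A,
  definable (fun r => realizes RQ A (fun n => r (S n)) (r 0)).
Proof.
  intros HQ. pose proof definable_app as HA.
  induction A; cbn; unfold good; definability.
  - exact (definable_at _ IHA1 (fun n => S (S (S n))) 1).
  - exact (definable_at _ IHA2 (fun n => S (S (S n))) 0).
  - exact (definable_at _ IHA1 (fun n => S (S n)) 0).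
  - exact (definable_at _ IHA2 (fun n => S (S n)) 0).
  - exact (definable_at _ IHA1 (fun n => S (S n)) 0).
  - exact (definable_at _ IHA2 (fun n => S (S (S n))) 0).
  - exact (definable_at_scons _ IHA 1 (fun n => S (S (S n))) 0).
  - exact (definable_at_scons _ IHA 1 (fun n => S (S (S n))) 0).
Qed.

(** * The fixed point *)

(** [F RQ r] is a condition on [r] together with a definable conjunction of
    instances of [RQ].  Existential quantifiers and disjunctions would destroy
    this form, unless they are decided by [r]. *)
Definition deterministic (F : (D -> D -> Prop) -> (nat -> D) -> Prop) : Prop :=
  exists (C : (nat -> D) -> Prop) (R : D -> D -> (nat -> D) -> Prop),
    definable C /\ definable (fun r => R (r 0) (r 1) (fun n => r (S (S n)))) /\
    forall RQ r, F RQ r <-> C r /\ forall h x, R h x r -> RQ h x.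

Lemma deterministic_iff F G : (forall RQ r, F RQ r <-> G RQ r) ->
  deterministic F -> deterministic G.
Proof.
  intros H (C & R & HC & HR & HF). exists C, R. split; [assumption|].
  split; [assumption|]. intros RQ r. rewrite <- H. apply HF.
Qed.

Lemma deterministic_definable C : definable C -> deterministic (fun _ => C).
Proof.
  intros HC. exists C, (fun _ _ _ => False). split; [assumption|].
  split; [apply definable_false|]. intros RQ r. tauto.
Qed.

Lemma deterministic_atom i j : deterministic (fun RQ r => RQ (r i) (r j)).
Proof.
  exists (fun _ => True), (fun h x r => h = r i /\ x = r j).
  split; [apply definable_true|]. split; [definability|].
  intros RQ r. split.
  - intros H. split; [exact I|]. intros h x [-> ->]; assumption.
  - intros [_ H]. auto.
Qed.

Lemma deterministic_and F G : deterministic F -> deterministic G ->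
  deterministic (fun RQ r => F RQ r /\ G RQ r).
Proof.
  intros (C & R & HC & HR & HF) (C' & R' & HC' & HR' & HG).
  exists (fun r => C r /\ C' r), (fun h x r => R h x r \/ R' h x r).
  split; [apply definable_and; assumption|]. split; [apply definable_or; assumption|].
  intros RQ r. rewrite HF, HG. split.
  - intros [[H1 H2] [H3 H4]]. split; [auto|]. intros h x [H|H]; auto.
  - intros [[H1 H2] H]. auto 6.
Qed.

Lemma deterministic_imp A F : definable A -> deterministic F ->
  deterministic (fun RQ r => A r -> F RQ r).
Proof.
  intros HA (C & R & HC & HR & HF).
  exists (fun r => A r -> C r), (fun h x r => A r /\ R h x r).
  split; [apply definable_imp; assumption|]. split.
  - apply definable_and; [|assumption]. exact (definable_ren A (fun n => S (S n)) HA).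
  - intros RQ r. split.
    + intros H. split; [intros Ha; apply (HF RQ r); auto|].
      intros h x [Ha Hx]. apply (HF RQ r); auto.
    + intros [H1 H2] Ha. apply HF. auto.
Qed.

Lemma deterministic_all (G : D -> (D -> D -> Prop) -> (nat -> D) -> Prop) :
  deterministic (fun RQ r => G (r 0) RQ (fun n => r (S n))) ->
  deterministic (fun RQ r => forall x, G x RQ r).
Proof.
  intros (C & R & HC & HR & HF).
  exists (fun r => forall y, C (scons y r)), (fun h x r => exists y, R h x (scons y r)).
  split; [apply definable_all_scons; assumption|]. split.
  - apply (definable_ex (fun y r => R (r 0) (r 1) (scons y (fun n => r (S (S n)))))).
    apply definable_iff with (fun r => R (r 1) (r 2) (fun n => r (scons 0 (fun n => S (S (S n))) n))).
    + intros r. replace (scons (r 0) (fun n => r (S (S (S n)))))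
        with (fun n => r (scons 0 (fun n => S (S (S n))) n)); [reflexivity|].
      apply functional_extensionality; intros [|n]; reflexivity.
    + exact (definable_ren _ (scons 1 (scons 2 (scons 0 (fun n => S (S (S n)))))) HR).
  - intros RQ r. split.
    + intros H. split.
      * intros y. apply (HF RQ (scons y r)), H.
      * intros h x [y Hy]. apply (HF RQ (scons y r)); [apply H|assumption].
    + intros [H1 H2] y. apply (HF RQ (scons y r)). eauto.
Qed.

Lemma deterministic_at (F : (D -> D -> Prop) -> (nat -> D) -> D -> Prop) :
  deterministic (fun RQ r => F RQ (fun n => r (S n)) (r 0)) ->
  forall f i, deterministic (fun RQ r => F RQ (fun n => r (f n)) (r i)).
Proof.
  intros (C & R & HC & HR & HF) f i.
  exists (fun r => C (fun n => r (scons i f n))),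
    (fun h x r => R h x (fun n => r (scons i f n))).
  split; [exact (definable_ren _ (scons i f) HC)|]. split.
  - exact (definable_ren _ (scons 0 (scons 1 (fun n => S (S (scons i f n))))) HR).
  - intros RQ r. exact (HF RQ (fun n => r (scons i f n))).
Qed.

Lemma deterministic_at_scons (F : (D -> D -> Prop) -> (nat -> D) -> D -> Prop) :
  deterministic (fun RQ r => F RQ (fun n => r (S n)) (r 0)) ->
  forall j f i, deterministic (fun RQ r => F RQ (scons (r j) (fun n => r (f n))) (r i)).
Proof.
  intros H j f i.
  apply deterministic_iff with (fun RQ r => F RQ (fun n => r (scons j f n)) (r i)).
  - intros RQ r. replace (scons (r j) (fun n => r (f n)))
      with (fun n => r (scons j f n)); [reflexivity|].
    apply functional_extensionality; intros [|n]; reflexivity.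
  - apply (deterministic_at F H).
Qed.

Lemma realizes_X_free RQ RQ' A : X_free A -> forall r h,
  realizes RQ (replace_X_by_Q A) r h <-> realizes RQ' (replace_X_by_Q A) r h.
Proof.
  unfold replace_X_by_Q.
  induction A; cbn; intros HX r h; try reflexivity;
    try match type of HX with _ /\ _ => destruct HX as [H1 H2] end.
  - destruct HX.
  - split; intros (a & b & H & Ha & Hb); exists a, b;
      apply IHA1 in Ha; apply IHA2 in Hb; auto.
  - split; intros (a & [[H Ha]|[H Ha]]); exists a;
      [left; apply IHA1 in Ha|right; apply IHA2 in Ha|
       left; apply IHA1 in Ha|right; apply IHA2 in Ha]; auto.
  - split; intros H a Ha; apply IHA1 in Ha; auto;
      (eapply good_mono; [|exact (H a Ha)]); intros v; apply IHA2; auto.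
  - split; intros H x; (eapply good_mono; [|exact (H x)]); intros v; apply IHA; auto.
  - split; intros (x & a & H & Ha); exists x, a; apply IHA in Ha; auto.
Qed.

(** A realizer determines the witness of an existential quantifier and the
    disjunct of a disjunction.  Hence in these clauses, as well as for
    conjunctions, existential quantification over the components of the
    realizer may be replaced by universal quantification over them, plus
    the [RQ]-free condition that they exist.  In an implication, strict
    positivity makes the realizability of the antecedent independent of [RQ]. *)
Lemma deterministic_realizes A : strictly_positive A ->
  deterministic (fun RQ r => realizes RQ (replace_X_by_Q A) (fun n => r (S n)) (r 0)).
Proof.
  pose proof definable_app as HA. unfold replace_X_by_Q.
  induction A; cbn; intros HP; try match type of HP with _ /\ _ => destruct HP as [HP1 HP2] end.
  - apply deterministic_definable. definability.
  - apply deterministic_definable. definability.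
  - apply deterministic_definable. definability.
  - exact (deterministic_atom 0 (S x)).
  - apply deterministic_iff with (fun RQ r => (exists a b, r 0 = pr a b) /\
      forall a b, r 0 = pr a b ->
      realizes RQ (replace_X_by_Q A1) (fun n => r (S n)) a /\
      realizes RQ (replace_X_by_Q A2) (fun n => r (S n)) b).
    { intros RQ r. split.
      - intros [(a & b & H) H']. exists a, b. auto.
      - intros (a & b & H & H'). split; [eauto|]. intros a' b' E. rewrite E in H.
        apply pr_inj in H. destruct H as [-> ->]. assumption. }
    apply deterministic_and; [apply deterministic_definable; definability|].
    apply (deterministic_all (fun a RQ r => forall b, r 0 = pr a b ->
      realizes RQ (replace_X_by_Q A1) (fun n => r (S n)) a /\
      realizes RQ (replace_X_by_Q A2) (fun n => r (S n)) b)).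
    apply (deterministic_all (fun b RQ r => r 1 = pr (r 0) b ->
      realizes RQ (replace_X_by_Q A1) (fun n => r (S (S n))) (r 0) /\
      realizes RQ (replace_X_by_Q A2) (fun n => r (S (S n))) b)).
    apply deterministic_imp; [definability|]. apply deterministic_and.
    + exact (deterministic_at (fun RQ => realizes RQ (replace_X_by_Q A1)) (IHA1 HP1) (fun n => S (S (S n))) 1).
    + exact (deterministic_at (fun RQ => realizes RQ (replace_X_by_Q A2)) (IHA2 HP2) (fun n => S (S (S n))) 0).
  - apply deterministic_iff with (fun RQ r =>
      (exists a, r 0 = pr (num 0) a \/ r 0 = pr (num 1) a) /\
      forall a,
      (r 0 = pr (num 0) a -> realizes RQ (replace_X_by_Q A1) (fun n => r (S n)) a) /\
      (r 0 = pr (num 1) a -> realizes RQ (replace_X_by_Q A2) (fun n => r (S n)) a)).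
    { intros RQ r. split.
      - intros [(a & [H|H]) H']; exists a; [left|right]; split; auto; apply H'; assumption.
      - intros (a & [[H H']|[H H']]); (split; [eauto|]); intros b; rewrite H; split;
          intros E; apply pr_inj in E; destruct E as [E <-]; try assumption;
          apply num_inj in E; discriminate. }
    apply deterministic_and; [apply deterministic_definable; definability|].
    apply (deterministic_all (fun a RQ r =>
      (r 0 = pr (num 0) a -> realizes RQ (replace_X_by_Q A1) (fun n => r (S n)) a) /\
      (r 0 = pr (num 1) a -> realizes RQ (replace_X_by_Q A2) (fun n => r (S n)) a))).
    apply deterministic_and; (apply deterministic_imp; [definability|]).
    + exact (deterministic_at (fun RQ => realizes RQ (replace_X_by_Q A1)) (IHA1 HP1) (fun n => S (S n)) 0).
    + exact (deterministic_at (fun RQ => realizes RQ (replace_X_by_Q A2)) (IHA2 HP2) (fun n => S (S n)) 0).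
  - set (N := fun _ _ : D => True).
    assert (HN : definable2 N) by (intros s t _ _; apply definable_true).
    assert (HN1 := definable_realizes N HN (replace_X_by_Q A1)).
    apply deterministic_iff with (fun RQ r => forall a,
      realizes N (replace_X_by_Q A1) (fun n => r (S n)) a ->
      (exists v, app (r 0) a v) /\ forall v, app (r 0) a v ->
        realizes RQ (replace_X_by_Q A2) (fun n => r (S n)) v).
    { intros RQ r. split; intros H a Ha; apply H;
        eapply realizes_X_free; eassumption. }
    apply (deterministic_all (fun a RQ r =>
      realizes N (replace_X_by_Q A1) (fun n => r (S n)) a ->
      (exists v, app (r 0) a v) /\ forall v, app (r 0) a v ->
        realizes RQ (replace_X_by_Q A2) (fun n => r (S n)) v)).
    apply deterministic_imp; [exact (definable_at _ HN1 (fun n => S (S n)) 0)|].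
    apply deterministic_and; [apply deterministic_definable; definability|].
    apply (deterministic_all (fun v RQ r => app (r 1) (r 0) v ->
        realizes RQ (replace_X_by_Q A2) (fun n => r (S (S n))) v)).
    apply deterministic_imp; [definability|].
    exact (deterministic_at (fun RQ => realizes RQ (replace_X_by_Q A2)) (IHA2 HP2) (fun n => S (S (S n))) 0).
  - apply (deterministic_all (fun x RQ r => (exists v, app (r 0) x v) /\
      forall v, app (r 0) x v ->
        realizes RQ (replace_X_by_Q A) (scons x (fun n => r (S n))) v)).
    apply deterministic_and; [apply deterministic_definable; definability|].
    apply (deterministic_all (fun v RQ r => app (r 1) (r 0) v ->
        realizes RQ (replace_X_by_Q A) (scons (r 0) (fun n => r (S (S n)))) v)).
    apply deterministic_imp; [definability|].
    exact (deterministic_at_scons (fun RQ => realizes RQ (replace_X_by_Q A)) (IHA HP) 1 (fun n => S (S (S n))) 0).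
  - apply deterministic_iff with (fun RQ r => (exists x a, r 0 = pr x a) /\
      forall x a, r 0 = pr x a ->
      realizes RQ (replace_X_by_Q A) (scons x (fun n => r (S n))) a).
    { intros RQ r. split.
      - intros [(x & a & H) H']. exists x, a. auto.
      - intros (x & a & H & H'). split; [eauto|]. intros x' a' E. rewrite E in H.
        apply pr_inj in H. destruct H as [-> ->]. assumption. }
    apply deterministic_and; [apply deterministic_definable; definability|].
    apply (deterministic_all (fun x RQ r => forall a, r 0 = pr x a ->
      realizes RQ (replace_X_by_Q A) (scons x (fun n => r (S n))) a)).
    apply (deterministic_all (fun a RQ r => r 1 = pr (r 0) a ->
      realizes RQ (replace_X_by_Q A) (scons (r 0) (fun n => r (S (S n)))) a)).
    apply deterministic_imp; [definability|].
    exact (deterministic_at_scons (fun RQ => realizes RQ (replace_X_by_Q A)) (IHA HP) 1 (fun n => S (S (S n))) 0).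
Qed.

(** The complement of [RQ] consists of the pairs from which a failure of [C]
    can be reached along [R].  In [C] and [R] variable 0 is the realizer and
    variable 1 the argument; as [A] has just one free variable, all others
    may be set to the argument. *)
Lemma fixed_point_exists A : closed_below 1 A -> strictly_positive A ->
  exists RQ, definable2 RQ /\ forall h x r,
    RQ h x <-> realizes RQ (replace_X_by_Q A) (scons x r) h.
Proof.
  intros HA HP. destruct (deterministic_realizes A HP) as (C & R & HC & HR & H).
  set (F := fun (X : D -> Prop) s => exists h x, s = pr h x /\
    (~ C (scons h (fun _ => x)) \/
     exists h' x', R h' x' (scons h (fun _ => x)) /\ X (pr h' x'))).
  assert (HM : monotone F).
  { intros X Y s HXY (h & x & Hs & [Hc|(h' & x' & Hr & Hx)]); exists h, x;
      (split; [assumption|]); [left; assumption|right; exists h', x'; auto]. }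
  assert (HF : finitary F).
  { intros X s (h & x & Hs & [Hc|(h' & x' & Hr & Hx)]).
    - exists nil. split; [intros y []|]. exists h, x. auto.
    - exists (pr h' x' :: nil). split; [intros y [<-|[]]; assumption|].
      exists h, x. split; [assumption|]. right. exists h', x'. cbn; auto. }
  assert (HC2 : definable2 (fun h x => C (scons h (fun _ => x)))).
  { apply definable2_intro.
    apply definable_iff with (fun r => C (fun n => r (scons 0 (fun _ => 1) n))).
    - intros r. replace (scons (r 0) (fun _ => r 1))
        with (fun n => r (scons 0 (fun _ => 1) n)); [reflexivity|].
      apply functional_extensionality; intros [|n]; reflexivity.
    - exact (definable_ren _ (scons 0 (fun _ => 1)) HC). }
  assert (HR4 : forall i j k l, definable (fun r => R (r i) (r j) (scons (r k) (fun _ => r l)))).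
  { intros i j k l.
    apply definable_iff with (fun r => R (r i) (r j) (fun n => r (scons k (fun _ => l) n))).
    - intros r. replace (scons (r k) (fun _ => r l))
        with (fun n => r (scons k (fun _ => l) n)); [reflexivity|].
      apply functional_extensionality; intros [|n]; reflexivity.
    - exact (definable_ren _ (scons i (scons j (scons k (fun _ => l)))) HR). }
  assert (HD : definable (fun r => fixpoint F (r 0))).
  { apply definable_fixpoint. unfold F. definability.
    - apply (HC2 (fun r => r 1) (fun r => r 0)); definability.
    - apply HR4. }
  exists (fun h x => ~ fixpoint F (pr h x)). split.
  - intros s t Hs Ht. apply definable_imp; [|apply definable_false].
    apply (definable_comp (fun y _ => fixpoint F y) (fun r => pr (s r) (t r))).
    + apply definable_fun_pr; assumption.
    + exact HD.
  - intros h x r. set (RQ := fun h x => ~ fixpoint F (pr h x)).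
    assert (HA' : closed_below 1 (replace_X_by_Q A)).
    { clear - HA. unfold replace_X_by_Q. revert HA. generalize 1.
      induction A; cbn; intros n HA; try destruct HA; auto. }
    rewrite (realizes_ext_below RQ _ 1 _ (fun _ => x) h HA').
    2: { intros [|k] Hk; [reflexivity|lia]. }
    pose proof (H RQ (scons h (fun _ => x))) as HE. cbn in HE. rewrite HE.
    rewrite (fixpoint_unfold F HM HF). split.
    + intros HN. split.
      * apply NNPP. intros Hc. apply HN. exists h, x. auto.
      * intros h' x' Hr Hx. apply HN. exists h, x. split; [reflexivity|]. right; eauto.
    + intros [Hc Hr] (h' & x' & E & HN). apply pr_inj in E. destruct E as [<- <-].
      destruct HN as [HN|(h' & x' & HR' & HN)]; [auto|]. exact (Hr h' x' HR' HN).
Qed.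

(** * Soundness *)

Lemma good_lam_hyp r h t (P Q : D -> Prop) :
  (forall a, P a -> good (eval r (scons a h) t) Q) ->
  good (eval r h (lam_hyp t)) (fun e => forall a, P a -> good (app e a) Q).
Proof.
  intros H. apply (good_closure _ _ _ (closure_lam_hyp r h t)).
  intros e He a Ha. apply (good_iff _ _ _ (He a)). auto.
Qed.

Lemma good_lam_set r h t (Q : D -> D -> Prop) :
  (forall x, good (eval (scons x r) h t) (Q x)) ->
  good (eval r h (lam_set t)) (fun e => forall x, good (app e x) (Q x)).
Proof.
  intros H. apply (good_closure _ _ _ (closure_lam_set r h t)).
  intros e He x. apply (good_iff _ _ _ (He x)). auto.
Qed.

Definition realizes_all (RQ : D -> D -> Prop) (G : list Q_form) (r h : nat -> D) : Prop :=
  forall i B, nth_error G i = Some B -> realizes RQ B r (h i).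

Lemma realizes_all_cons RQ G A r h a :
  realizes RQ A r a -> realizes_all RQ G r h -> realizes_all RQ (A :: G) r (scons a h).
Proof.
  intros Ha H [|i] B; cbn; [intros [= <-]; assumption|apply H].
Qed.

Lemma realizes_all_shift RQ G r h x :
  realizes_all RQ G r h -> realizes_all RQ (map shift G) (scons x r) h.
Proof.
  intros H i B E. rewrite nth_error_map in E.
  destruct (@nth_error (form Q_symbol) G i) as [C|] eqn:EC; [|discriminate E].
  injection E as <-. apply realizes_ren. apply H. assumption.
Qed.

Lemma realizes_inst RQ A y r h :
  realizes RQ (inst A y) r h <-> realizes RQ A (scons (r y) r) h.
Proof.
  unfold inst. rewrite realizes_ren.
  replace (fun n => r match n with 0 => y | S k => k end) with (scons (r y) r);
    [reflexivity|].
  apply functional_extensionality; intros [|n]; reflexivity.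
Qed.

(** The program depends only on the derivation, so that it can be
    abstracted over individual variables and hypotheses. *)
Theorem soundness RQ G A : nd intuitionistic G A ->
  exists t, forall r h, realizes_all RQ G r h ->
  good (eval r h t) (realizes RQ A r).
Proof.
  induction 1.
  - destruct (In_nth_error _ _ H) as [i Hi]. exists (HVar i). intros r h HG.
    apply good_value. apply HG. assumption.
  - destruct IHnd as [t Ht]. exists t. intros r h HG.
    eapply good_mono; [|apply (Ht r h HG)]. intros v [].
  - discriminate.
  - destruct IHnd1 as [s Hs], IHnd2 as [t Ht]. exists (Pair s t).
    intros r h HG. eapply good_pair; [apply Hs, HG|apply Ht, HG|].
    intros a b Ha Hb. cbn. eauto.
  - destruct IHnd as [t Ht]. exists (split_pair t (PVar 0)). intros r h HG.
    eapply good_split; [apply Ht, HG|]. intros a b [Ha Hb]. apply good_value. exact Ha.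
  - destruct IHnd as [t Ht]. exists (split_pair t (HVar 0)). intros r h HG.
    eapply good_split; [apply Ht, HG|]. intros a b [Ha Hb]. apply good_value. exact Hb.
  - destruct IHnd as [t Ht]. exists (Pair (Num 0) t). intros r h HG.
    eapply good_pair with (P := fun v => v = num 0);
      [apply good_value; reflexivity|apply Ht, HG|].
    intros ? a -> Ha. exists a. auto.
  - destruct IHnd as [t Ht]. exists (Pair (Num 1) t). intros r h HG.
    eapply good_pair with (P := fun v => v = num 1);
      [apply good_value; reflexivity|apply Ht, HG|].
    intros ? a -> Ha. exists a. auto.
  - destruct IHnd1 as [s Hs], IHnd2 as [t Ht], IHnd3 as [u Hu].
    exists (case_of s t u). intros r h HG. eapply good_case; [apply Hs, HG|..].
    + intros a Ha. apply Ht. apply realizes_all_cons; assumption.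
    + intros a Ha. apply Hu. apply realizes_all_cons; assumption.
  - destruct IHnd as [t Ht]. exists (lam_hyp t). intros r h HG.
    apply good_lam_hyp. intros a Ha. apply Ht. apply realizes_all_cons; assumption.
  - destruct IHnd1 as [s Hs], IHnd2 as [t Ht]. exists (App s t).
    intros r h HG. eapply good_app; [apply Hs, HG|apply Ht, HG|].
    intros a b Ha Hb. apply Ha, Hb.
  - destruct IHnd as [t Ht]. exists (lam_set t). intros r h HG.
    apply (good_lam_set r h t (fun x => realizes RQ A (scons x r))).
    intros x. apply Ht. apply realizes_all_shift, HG.
  - destruct IHnd as [t Ht]. exists (App t (PVar y)). intros r h HG.
    eapply good_app with (Q := fun v => v = r y);
      [apply Ht, HG|apply good_value; reflexivity|].
    intros a b Ha ->. eapply good_mono; [|apply Ha]. intros v. apply realizes_inst.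
  - destruct IHnd as [t Ht]. exists (Pair (PVar y) t). intros r h HG.
    eapply good_pair with (P := fun v => v = r y);
      [apply good_value; reflexivity|apply Ht, HG|].
    intros ? a -> Ha. exists (r y), a. split; [reflexivity|]. apply realizes_inst, Ha.
  - destruct IHnd1 as [s Hs], IHnd2 as [t Ht]. exists (split_pair s t).
    intros r h HG. eapply good_split; [apply Hs, HG|]. intros x a Ha.
    apply good_mono with (realizes RQ (shift C) (scons x r)).
    + intros v. exact (proj1 (realizes_ren RQ C S (scons x r) v)).
    + apply Ht. apply realizes_all_cons; [exact Ha|]. apply realizes_all_shift, HG.
  - exists (Num 0). intros r h HG. apply good_value. reflexivity.
  - destruct IHnd1 as [s Hs], IHnd2 as [t Ht]. exists t. intros r h HG.
    destruct (good_inhabited _ _ (Hs r h HG)) as [a Ha]. cbn in Ha.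
    eapply good_mono; [|apply Ht, HG]. intros v Hv. apply realizes_inst.
    rewrite <- Ha. apply realizes_inst. exact Hv.
Qed.

(** * Realizing the axioms *)

(** Given [f], this is a code [g] with [g x = f x (fun y a => g y)]; the bound
    [a], a realizer of [y] being in [x], is discarded.  Self-application
    [w w] is delayed by the abstractions over [y] and [a]. *)
Definition recursor : program :=
  lam_hyp (App (lam_hyp (App (HVar 0) (HVar 0)))
    (lam_hyp (lam_set (App (App (HVar 1) (PVar 0))
      (lam_set (lam_hyp (App (App (HVar 1) (HVar 1)) (PVar 0)))))))).

(** If [f] realizes that [A] is progressive, the code [g] of the recursive program
    satisfies: if it is good at all elements of [x], then it is good at [x].
    This is a progressive definable class of the model. *)
Lemma foundation_realized RQ A : definable2 RQ ->
  exists h, forall r, realizes RQ (foundation A) r h.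
Proof.
  intros HQ. set (r0 := fun _ : nat => inhabitant).
  apply (good_inhabited (eval r0 r0 recursor)).
  assert (HD : definable (fun r => good (app (r 1) (r 0))
            (realizes RQ A (scons (r 0) (fun n => r (S (S n))))))).
  { pose proof definable_app as HA. unfold good. definability.
    exact (definable_at_scons _ (definable_realizes RQ HQ A) 1 (fun n => S (S (S n))) 0). }
  apply (good_closure _ _ _ (closure_lam_hyp r0 r0 _)).
  intros e He r f Hf. apply (good_iff _ _ _ (He f)). clear e He.
  set (W := lam_hyp (lam_set _)).
  (* [w] is the only value of [W], and [g], the recursive function, that of [w w]. *)
  destruct (closure_lam_hyp r0 (scons f r0) (lam_set (App (App (HVar 1) (PVar 0))
      (lam_set (lam_hyp (App (App (HVar 1) (HVar 1)) (PVar 0))))))) as (w & Hw & Hw').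
  fold W in Hw.
  destruct (closure_lam_set r0 (scons w (scons f r0)) (App (App (HVar 1) (PVar 0))
      (lam_set (lam_hyp (App (App (HVar 1) (HVar 1)) (PVar 0)))))) as (g & Hg & Hg').
  assert (Hww : forall v, app w w v <-> v = g).
  { intros v. rewrite Hw'. apply Hg. }
  apply good_app with (P := fun d => forall v, app d w v <-> v = g) (Q := fun v => v = w).
  { apply (good_closure _ _ _ (closure_lam_hyp _ _ _)). intros d Hd v. rewrite Hd.
    cbn. split.
    - intros (a & b & -> & -> & Hv). apply Hww, Hv.
    - intros ->. exists w, w. split; [reflexivity|]. split; [reflexivity|].
      apply Hww. reflexivity. }
  { apply (good_iff _ _ _ Hw), good_value. reflexivity. }
  intros d ? Hd ->. apply (good_iff _ _ _ Hd), good_value.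
  cbn [realizes]. intros x. revert x.
  apply (foundation_definable _ HD (scons g r)). cbn. intros x IH.
  apply (good_iff _ _ _ (Hg' x)).
  apply good_app with
    (P := fun k => forall u, realizes RQ (All (Imp (Mem 0 1) (ren (up S) A))) (scons x r) u ->
            good (app k u) (realizes RQ A (scons x r)))
    (Q := realizes RQ (All (Imp (Mem 0 1) (ren (up S) A))) (scons x r)).
  - apply good_app with (P := fun v => v = f) (Q := fun v => v = x).
    + apply good_value. reflexivity.
    + apply good_value. reflexivity.
    + intros ? ? -> ->. apply Hf.
  - apply (good_lam_set _ _ _ (fun y => realizes RQ (Imp (Mem 0 1) (ren (up S) A))
             (scons y (scons x r)))).
    intros y. apply good_lam_hyp. intros a Ha. cbn in Ha.
    apply good_app with (P := fun v => v = g) (Q := fun v => v = y).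
    + apply good_app with (P := fun v => v = w) (Q := fun v => v = w).
      * apply good_value. reflexivity.
      * apply good_value. reflexivity.
      * intros ? ? -> ->. apply (good_iff _ _ _ Hww), good_value. reflexivity.
    + apply good_value. reflexivity.
    + intros ? ? -> ->. eapply good_mono; [|exact (IH y Ha)]. intros v Hv.
      apply realizes_ren.
      replace (fun n => scons y (scons x r) (up S n)) with (scons y r); [exact Hv|].
      apply functional_extensionality; intros [|n]; reflexivity.
  - auto.
Qed.

Lemma alls_realized RQ n A : (exists h, forall r, realizes RQ A r h) ->
  exists h, forall r, realizes RQ (alls n A) r h.
Proof.
  induction n as [|n IH]; cbn; [auto|]. intros H. destruct (IH H) as [h Hh].
  exists (pr (num tag_const) h). intros r x.
  apply (good_iff _ (fun v => v = h)); [intros v; apply app_const|].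
  apply good_value. apply Hh.
Qed.

Lemma fixed_point_realized RQ A r :
  (forall h x r, RQ h x <-> realizes RQ (replace_X_by_Q A) (scons x r) h) ->
  exists h, realizes RQ (fixed_point_axiom A) r h.
Proof.
  intros H. set (r0 := fun _ : nat => inhabitant).
  apply (good_inhabited (eval r0 r0 (lam_set (Pair (lam_hyp (HVar 0)) (lam_hyp (HVar 0)))))).
  apply (good_lam_set _ _ _ (fun x => realizes RQ
    (Iff (Atom Q 0) (replace_X_by_Q A)) (scons x r))).
  intros x. eapply good_pair.
  - apply good_lam_hyp with (P := fun h => RQ h x)
      (Q := realizes RQ (replace_X_by_Q A) (scons x r)).
    intros a Ha. apply good_value, H, Ha.
  - apply good_lam_hyp with (Q := fun h => RQ h x)
      (P := realizes RQ (replace_X_by_Q A) (scons x r)).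
    intros a Ha. apply good_value. apply (H _ _ r). exact Ha.
  - intros a b Ha Hb. exists a, b. auto.
Qed.

(** The information that truth alone does not provide: a true disjunct, a
    witness of an existential formula. *)
Definition witness (A : set_form) (r : nat -> D) (v : D) : Prop :=
  match A with
  | Or A B => v = pr (num 0) (num 0) /\ sat mem r A \/ v = pr (num 1) (num 0) /\ sat mem r B
  | Ex A => sat mem (scons v r) A
  | _ => False
  end.

Fixpoint subformulas (A : set_form) : list set_form :=
  A :: match A with
       | And A B | Or A B | Imp A B => subformulas A ++ subformulas B
       | All A | Ex A => subformulas A
       | _ => nil
       end.

Definition decides (L : list set_form) : Prop :=
  forall A, In A L -> exists t, forall r h v, eval r h t v <-> witness A r v.

(** Both parts are needed at once, because an implication exchanges
    them.  The program is applied only where its formula is true; it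
    may have no value elsewhere. *)
Lemma truth_realized RQ L A : decides L -> incl (subformulas A) L ->
  (forall r h, realizes RQ (embed A) r h -> sat mem r A) /\
  exists t, forall r h, sat mem r A -> good (eval r h t) (realizes RQ (embed A) r).
Proof.
  intros HL. unfold embed. induction A; intros HA; cbn in HA;
    try (apply incl_cons_inv in HA; destruct HA as [HA HB]);
    try (apply incl_app_inv in HB; destruct HB as [HB HC];
         destruct (IHA1 HB) as [H1 [s Hs]], (IHA2 HC) as [H2 [t Ht]]);
    try destruct (IHA HB) as [H1 [t Ht]]; cbn.
  - split; [auto|]. exists (Num 0). intros r h [].
  - split; [auto|]. exists (Num 0). intros r h H. apply good_value, H.
  - split; [auto|]. exists (Num 0). intros r h H. apply good_value, H.
  - destruct p.
  - split.
    + intros r h (a & b & _ & Ha & Hb). eauto.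
    + exists (Pair s t). intros r h [Ha Hb].
      eapply good_pair; [apply Hs, Ha|apply Ht, Hb|]. intros a b Ha' Hb'. eauto.
  - split.
    + intros r h (a & [[_ Ha]|[_ Ha]]); eauto.
    + destruct (HL _ HA) as [o Ho].
      exists (case_of o (Pair (Num 0) s) (Pair (Num 1) t)). intros r h H.
      apply good_case with (P := fun _ => sat mem r A1) (Q := fun _ => sat mem r A2).
      * apply (good_iff _ _ _ (Ho r h)). split.
        -- destruct H as [H|H]; [exists (pr (num 0) (num 0))|exists (pr (num 1) (num 0))];
             cbn; auto.
        -- intros v [[-> Hv]|[-> Hv]]; exists (num 0); auto.
      * intros a Ha. eapply good_pair with (P := fun v => v = num 0);
          [apply good_value; reflexivity|apply Hs, Ha|]. intros ? b -> Hb. eauto.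
      * intros a Ha. eapply good_pair with (P := fun v => v = num 1);
          [apply good_value; reflexivity|apply Ht, Ha|]. intros ? b -> Hb. eauto.
  - split.
    + intros r h H Ha. destruct (good_inhabited _ _ (Hs r r Ha)) as [a Ha'].
      destruct (good_inhabited _ _ (H a Ha')) as [b Hb]. eauto.
    + exists (lam_hyp t). intros r h H. apply good_lam_hyp. intros a Ha. apply Ht. eauto.
  - split.
    + intros r h H x. destruct (good_inhabited _ _ (H x)) as [b Hb]. eauto.
    + exists (lam_set t). intros r h H.
      apply (good_lam_set r h t (fun x => realizes RQ _ (scons x r))). auto.
  - split.
    + intros r h (x & a & _ & Ha). eauto.
    + destruct (HL _ HA) as [o Ho].
      exists (App (lam_set (Pair (PVar 0) t)) o). intros r h H.
      eapply good_app with (Q := fun v => sat mem (scons v r) A).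
      * apply (good_closure _ _ (fun e => forall c v, app e c v <->
          eval (scons c r) h (Pair (PVar 0) t) v) (closure_lam_set r h _)). auto.
      * apply (good_iff _ _ _ (Ho r h)). split; auto.
      * intros e x He Hx. apply (good_iff _ _ _ (He x)).
        eapply good_pair with (P := fun v => v = x);
          [apply good_value; reflexivity|apply Ht, Hx|]. intros ? a -> Ha. eauto.
Qed.

End Application.

(** * The oracle *)

Fixpoint tuple (m : nat) (r : nat -> D) : D :=
  match m with
  | O => num 0
  | S m => pr (r 0) (tuple m (fun n => r (S n)))
  end.

Lemma tuple_inj m : forall r s, tuple m r = tuple m s -> forall k, k < m -> r k = s k.
Proof.
  induction m as [|m IH]; cbn; intros r s H k Hk; [lia|].
  apply pr_inj in H. destruct H as [H0 H]. destruct k as [|k]; [assumption|].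
  apply (IH _ _ H). lia.
Qed.

(** A tuple [s] in the model codes the first [m] values of a valuation, whose
    other values are taken from the environment.  In the induction step the
    first component of the tuple is moved to place [m] of the environment,
    which the tuple of length [m] leaves untouched. *)
Lemma definable_tuple m : forall R, definable R ->
  definable (fun r => exists s, r 0 = tuple m s /\
    R (fun n => if n <? m then s n else r (S n))).
Proof.
  induction m as [|m IH]; intros R HR.
  - apply definable_iff with (fun r => r 0 = num 0 /\ R (fun n => r (S n))).
    + intros r. cbn. split; [intros [H1 H2]; exists r; auto|intros [s H]; assumption].
    + apply (definable_and (fun r => r 0 = num 0)); [definability|].
      exact (definable_ren R S HR).
  - set (f := fun n => match n with 0 => m | S k => if k <? m then k else S k end).
    pose proof (IH _ (definable_ren R f HR)) as H.
    set (g := fun n => match n with 0 => 0 | S k => if k =? m then 1 else S (S (S k)) end).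
    apply (definable_ren _ g) in H.
    apply definable_iff with (fun r => exists x c, r 0 = pr x c /\ exists s, c = tuple m s /\
      R (fun n => if n <? S m then scons x s n else r (S n))).
    + intros r. split.
      * intros (x & c & Hr & s & -> & Hs). exists (scons x s). auto.
      * intros (s & Hr & Hs). exists (s 0), (tuple m (fun n => s (S n))).
        split; [exact Hr|]. exists (fun n => s (S n)). split; [reflexivity|].
        rewrite scons_eta. exact Hs.
    + apply (definable_ex (fun x r => exists c, r 0 = pr x c /\ exists s, c = tuple m s /\
        R (fun n => if n <? S m then scons x s n else r (S n)))).
      apply (definable_ex (fun c r => r 1 = pr (r 0) c /\ exists s, c = tuple m s /\
        R (fun n => if n <? S m then scons (r 0) s n else r (S (S n))))).
      apply (definable_and (fun r => r 2 = pr (r 1) (r 0))); [definability|].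
      eapply definable_iff; [|exact H]. intros r. cbn.
      assert (E : forall s : nat -> D,
        (fun n => if f n <? m then s (f n) else
                  r (if f n =? m then 1 else S (S (S (f n))))) =
        (fun n => if n <? S m then scons (r 1) s n else r (S (S (S n))))).
      { intros s. apply functional_extensionality. intros [|k]; unfold f.
        - rewrite Nat.ltb_irrefl, Nat.eqb_refl. reflexivity.
        - change (S k <? S m) with (k <? m). destruct (Nat.ltb_spec k m) as [Hk|Hk].
          + apply Nat.ltb_lt in Hk. rewrite Hk. reflexivity.
          + destruct (Nat.ltb_spec (S k) m); [lia|].
            destruct (Nat.eqb_spec (S k) m); [lia|]. reflexivity. }
      split; intros (s & Hs & HRs); exists s; (split; [exact Hs|]);
        [rewrite <- E|rewrite E]; exact HRs.
Qed.

Lemma definable_witness A : definable (fun r => witness A (fun n => r (S n)) (r 0)).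
Proof.
  destruct A; cbn; definability.
  - apply (definable_ren (fun r => sat mem r A1) S). exists A1. reflexivity.
  - apply (definable_ren (fun r => sat mem r A2) S). exists A2. reflexivity.
  - exists A. intros r. rewrite scons_eta. reflexivity.
Qed.

Lemma witness_ext_below A n r s v :
  closed_below n A -> (forall k, k < n -> r k = s k) -> witness A r v <-> witness A s v.
Proof.
  destruct A; cbn; intros Hc H; try reflexivity.
  - destruct Hc as [H1 H2]. rewrite (sat_ext_below _ _ _ _ r s H1 H),
      (sat_ext_below _ _ _ _ r s H2 H). reflexivity.
  - apply (sat_ext_below _ _ _ _ _ _ Hc). intros [|k] Hk; [reflexivity|].
    apply H. lia.
Qed.

(** The tags from [k] on select a formula in [L]; the argument [c] codes the
    values of its variables.  This is definable for a fixed list [L]. *)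
Fixpoint oracle_from (m k : nat) (L : list set_form) (t c v : D) : Prop :=
  match L with
  | nil => False
  | A :: L => t = num k /\ (exists s, c = tuple m s /\ witness A s v) \/
              oracle_from m (S k) L t c v
  end.

Lemma definable_oracle_from m L : (forall A, In A L -> closed_below m A) ->
  forall k, definable3 (oracle_from m k L).
Proof.
  intros HL. induction L as [|A L IH]; intros k; apply definable3_intro; cbn.
  - apply definable_false.
  - assert (IH' := IH (fun B HB => HL B (or_intror HB)) (S k)).
    definability.
    pose proof (definable_at _ (definable_witness A) (fun n => n) m) as H.
    apply definable_tuple with (m := m) in H.
    apply (definable_ren _ (fun n => match n with 0 => 1 | _ => 2 end)) in H.
    eapply definable_iff; [|exact H]. intros r. cbn beta iota. rewrite Nat.ltb_irrefl.
    split; intros (s & Hc & Hs); exists s; (split; [exact Hc|]);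
      (eapply witness_ext_below; [apply HL; left; reflexivity| |exact Hs]);
      intros i Hi; apply Nat.ltb_lt in Hi; cbn beta; rewrite Hi; reflexivity.
Qed.

Lemma oracle_from_tag m L : forall k t c v,
  oracle_from m k L t c v -> exists n, t = num (k + n).
Proof.
  induction L as [|A L IH]; cbn; intros k t c v H; [destruct H|].
  destruct H as [[-> _]|H].
  - exists 0. f_equal. lia.
  - destruct (IH _ _ _ _ H) as [n ->]. exists (S n). f_equal. lia.
Qed.

Lemma oracle_from_nth m L A c v : forall k i, nth_error L i = Some A ->
  oracle_from m k L (num (k + i)) c v <-> exists s, c = tuple m s /\ witness A s v.
Proof.
  induction L as [|B L IH]; intros k [|i] E; cbn in E |- *; try discriminate.
  - injection E as ->. rewrite Nat.add_0_r. split.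
    + intros [[_ H]|H]; [exact H|]. apply oracle_from_tag in H.
      destruct H as [n H]. apply num_inj in H. lia.
    + intros H. left. auto.
  - rewrite <- (IH (S k) i E). replace (S k + i) with (k + S i) by lia. split.
    + intros [[H _]|H]; [|exact H]. apply num_inj in H. lia.
    + intros H. right. exact H.
Qed.

Fixpoint tuple_program (m k : nat) : program :=
  match m with
  | O => Num 0
  | S m => Pair (PVar k) (tuple_program m (S k))
  end.

Lemma eval_tuple_program oracle r h m : forall k v,
  eval oracle r h (tuple_program m k) v <-> v = tuple m (fun n => r (k + n)).
Proof.
  induction m as [|m IH]; intros k v; cbn; [reflexivity|].
  replace (fun n => r (k + S n)) with (fun n => r (S k + n)).
  2: { apply functional_extensionality. intros n. f_equal. lia. }
  rewrite Nat.add_0_r. split.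
  - intros (a & b & -> & Hb & ->). apply IH in Hb. subst. reflexivity.
  - intros ->. exists (r k), (tuple m (fun n => r (S k + n))).
    split; [reflexivity|]. split; [|reflexivity]. apply IH. reflexivity.
Qed.

Lemma oracle_exists L : exists oracle, definable3 oracle /\
  (forall t c v, oracle t c v -> exists n, t = num (tag_oracle + n)) /\
  decides oracle L.
Proof.
  assert (HM : exists m, forall A, In A L -> closed_below m A).
  { induction L as [|A L [m IH]]; [exists 0; intros A []|].
    destruct (closed_below_exists _ A) as [n Hn]. exists (m + n).
    intros B [<-|HB]; (eapply closed_below_le; [|eauto]); lia. }
  destruct HM as [m HM]. exists (oracle_from m tag_oracle L).
  assert (HO : forall t c v, oracle_from m tag_oracle L t c v ->
                 exists n, t = num (tag_oracle + n)) by (intros ? ? ?; apply oracle_from_tag).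
  split; [apply definable_oracle_from, HM|]. split; [exact HO|].
  intros A HA. destruct (In_nth_error _ _ HA) as [i Hi].
  exists (App (Pair (Num (tag_oracle + i)) (Num 0)) (tuple_program m 0)).
  intros r h v. split.
  - intros (a & b & (x & y & -> & _ & ->) & Hb & H).
    apply app_oracle in H. apply eval_tuple_program in Hb. subst b.
    apply (oracle_from_nth _ _ A) in H; [|exact Hi]. destruct H as (s & E & H).
    apply (witness_ext_below A m r s v (HM A HA)); [|exact H].
    exact (tuple_inj _ _ _ E).
  - intros H. exists (pr (num (tag_oracle + i)) (num 0)), (tuple m r).
    split; [exists (num (tag_oracle + i)), (num 0); cbn; auto|].
    split; [apply eval_tuple_program; reflexivity|].
    apply app_oracle. apply (oracle_from_nth _ _ A); [exact Hi|]. eauto.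
Qed.

(** * Conservativity *)

(** A left inverse of [embed], to collect the set-theoretic axioms used in a
    derivation; its value on atoms is arbitrary. *)
Fixpoint erase (A : Q_form) : set_form :=
  match A with
  | Bot | Atom _ _ => Bot
  | Mem x y => Mem x y
  | Eq x y => Eq x y
  | And A B => And (erase A) (erase B)
  | Or A B => Or (erase A) (erase B)
  | Imp A B => Imp (erase A) (erase B)
  | All A => All (erase A)
  | Ex A => Ex (erase A)
  end.

Lemma erase_embed A : erase (embed A) = A.
Proof.
  unfold embed. induction A; cbn; rewrite ?IHA, ?IHA1, ?IHA2; try reflexivity.
  destruct p.
Qed.

Lemma choose_realizers RQ oracle G r :
  (forall B, In B G -> exists h, realizes oracle RQ B r h) ->
  exists h, realizes_all oracle RQ G r h.
Proof.
  induction G as [|B G IH]; intros H.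
  - exists r. intros [|i] B E; discriminate.
  - destruct IH as [h Hh]; [intros; apply H; right; assumption|].
    destruct (H B (or_introl eq_refl)) as [a Ha]. exists (scons a h).
    apply realizes_all_cons; assumption.
Qed.

(** The oracle is built for the formulas of the given derivation: its axioms
    from [T] must be realized, and its conclusion read off from a realizer. *)
Theorem FiX_truth T A B r : closed_below 1 A -> strictly_positive A ->
  (forall C, sentence C -> provable classical T C -> sat mem r C) ->
  provable intuitionistic (FiX T A) (embed B) -> sat mem r B.
Proof.
  intros HA HP HT [G [HG H]].
  set (L := flat_map subformulas (B :: map erase G)).
  assert (HL : forall C, In C (B :: map erase G) -> incl (subformulas C) L).
  { intros C HC E HE. apply in_flat_map. eauto. }
  destruct (oracle_exists L) as (oracle & HO & HO' & HD).
  destruct (fixed_point_exists oracle HO A HA HP) as (RQ & HR & HQ).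
  assert (HS : exists h, realizes_all oracle RQ G r h).
  { apply choose_realizers. intros C HC. destruct (HG C HC) as [E HE HE'|C' HC'|].
    - assert (HI : incl (subformulas E) L).
      { apply HL. right. rewrite <- (erase_embed E). apply in_map, HC. }
      destruct (truth_realized oracle HO' RQ L E HD HI) as [_ [t Ht]].
      exact (good_inhabited _ _ (Ht r r (HT E HE HE'))).
    - destruct HC' as [n E _].
      destruct (alls_realized oracle HO' RQ n _ (foundation_realized oracle HO HO' RQ E HR))
        as [h Hh]. eauto.
    - exact (fixed_point_realized oracle HO' RQ A r HQ). }
  destruct HS as [h Hh]. destruct (soundness oracle HO' RQ G _ H) as [t Ht].
  destruct (good_inhabited _ _ (Ht r h Hh)) as [v Hv].
  destruct (truth_realized oracle HO' RQ L B HD (HL B (or_introl eq_refl))) as [HB _].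
  exact (HB r v Hv).
Qed.

End Model.

Theorem theorem1p2
  (T : set_form -> Prop)
  (T_sentences : forall A, T A -> sentence A)
  (T_BS : contains_BS T)
  (D : X_form)
  (D_free : closed_below 1 D)
  (D_positive : strictly_positive D) :
  (forall A : set_form, sentence A ->
     provable classical T A ->
     provable intuitionistic (FiX T D) (embed A)) /\
  (forall A : set_form, sentence A ->
     provable intuitionistic (FiX T D) (embed A) ->
     provable classical T A).
Proof.
  split.
  - intros A HA H. exists (embed A :: nil). split.
    + intros B [<-|[]]. apply FiX_theorem; assumption.
    + apply nd_hyp. left. reflexivity.
  - intros A HA H. apply NNPP. intros HN.
    destruct (completeness T A T_sentences HA HN) as (M & mem & r & HT & HM).
    apply HM.
    assert (EXT := HT _ (T_BS _ BS_extensionality)).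
    assert (F0' := HT _ (T_BS _ (BS_totality F0 (or_introl eq_refl)))).
    assert (F1' := HT _ (T_BS _ (BS_totality F1 (or_intror (or_introl eq_refl))))).
    cbn in EXT, F0', F1'.
    apply (FiX_truth M mem) with (T := T) (A := D); auto.
    + intros x y. destruct (F0' x y) as (z & Hx & Hy & Hz). exists z. intros t.
      split; [apply Hz|]. intros [->| ->]; assumption.
    + intros x. destruct (F1' x x) as (z & Hz & Hz'). exists z. intros t. split.
      * intros Ht. apply Hz, Ht.
      * intros (u & Hu & Ht). exact (Hz' u Hu t Ht).
    + intros B s HB.
      destruct (closed_below_exists _ (foundation B)) as [n Hn].
      assert (HS : sentence (alls n (foundation B))).
      { apply closed_below_alls. rewrite Nat.add_0_r. assumption. }
      assert (HF : forall q, sat mem q (alls n (foundation B))).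
      { intros q. apply (sat_ext_below _ _ _ 0 r q HS); [intros; lia|].
        apply HT, T_BS, BS_foundation, foundation_instance, HS. }
      assert (HF' : forall q, sat mem q (foundation B)).
      { clear - HF. induction n as [|n IH]; [assumption|]. apply IH. intros q.
        rewrite <- (scons_eta _ q). apply (HF (fun k => q (S k))). }
      apply (HF' s). cbn. intros x IH. apply HB. intros y Hy.
      specialize (IH y Hy). rewrite sat_ren in IH.
      replace (scons y s) with (fun k => scons y (scons x s) (up S k)); [exact IH|].
      apply functional_extensionality; intros [|k]; reflexivity.
    + exact (r 0).
Qed.
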